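(* Let $0<p\le 1/2$ and let $\{q_k:k\ge 0\}$ be a non-decreasing sequence of non-negative numbers with $q_0>0$, satisfying $$\frac{q_{n-1}}{Q_n}=O\left(\frac1n\right)\quad\text{as } n\to\infty .$$ Then the maximal operator $$\widetilde{T}_p^{*}f:=\sup_{n\in\mathbb N_+}\frac{|T_nf|}{(n+1)^{1/p-2}\log^{2[1/2+p]}(n+1)}$$ is bounded from the martingale Hardy space $H_p$ to the space $L_p(G_m)$; that is, there is a constant $c_p$ such that $\|\widetilde{T}_p^{*}f\|_p\le c_p\|f\|_{H_p}$ for all $f\in H_p$.
   Context: $\mathbb N_+$ is the set of positive integers and $\mathbb N=\mathbb N_+\cup\{0\}$. $[x]$ denotes the integer part of $x$. Let $m=(m_0,m_1,\dots)$ be a sequence of integers $m_k\ge 2$ with $\sup_k m_k<\infty$, and let $Z_{m_k}=\{0,\dots,m_k-1\}$ be the additive group of integers modulo $m_k$ with the discrete topology. $G_m=\prod_k Z_{m_k}$ is the (bounded) Vilenkin group with the product topology, and $\mu$ is its Haar measure with $\mu(G_m)=1$ (the product of the uniform measures). Put $M_0=1$, $M_{k+1}=m_kM_k$; every $n\in\mathbb N$ is uniquely $n=\sum_{j\ge0}n_jM_j$ with $n_j\in Z_{m_j}$. For $x\in G_m$ let $I_0(x)=G_m$, $I_n(x)=\{y\in G_m: y_0=x_0,\dots,y_{n-1}=x_{n-1}\}$. Generalized Rademacher functions: $r_k(x)=\exp(2\pi i x_k/m_k)$; Vilenkin system: $\psi_n(x)=\prod_{k\ge 0} r_k(x)^{n_k}$.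 $\|f\|_p^p=\int_{G_m}|f|^p\,d\mu$. A martingale $f=(f^{(n)},n\in\mathbb N)$ is taken with respect to the $\sigma$-algebras $\digamma_n$ generated by $\{I_n(x):x\in G_m\}$; its maximal function is $f^*=\sup_n|f^{(n)}|$, and $H_p$ ($0<p<\infty$) consists of all martingales with $\|f\|_{H_p}:=\|f^*\|_p<\infty$. Vilenkin–Fourier coefficients of a martingale: $\widehat f(i)=\lim_{k\to\infty}\int_{G_m}f^{(k)}\overline{\psi_i}\,d\mu$. Partial sums: $S_nf=\sum_{k=0}^{n-1}\widehat f(k)\psi_k$ (so $S_0f=0$). The $T$ means generated by $\{q_k\}$: $T_nf=\frac1{Q_n}\sum_{k=0}^{n-1}q_kS_kf$ with $Q_n=\sum_{k=0}^{n-1}q_k$, $n\in\mathbb N_+$. *)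

(* Defs.v *)
From HB Require Import structures.
From mathcomp Require Import all_boot all_order all_algebra.
From mathcomp Require Import complex.
From mathcomp Require Import all_classical all_reals all_analysis.
Import Order.TTheory GRing.Theory Num.Theory.
Import numFieldNormedType.Exports.

Set Implicit Arguments.
Unset Strict Implicit.
Unset Printing Implicit Defensive.

Local Open Scope classical_set_scope.
Local Open Scope ring_scope.

(* 'Z_(m k) is the group of integers modulo m k only when 1 < m k. *)
Definition vilenkin_space (m : nat -> nat) :=
  prod_topology (fun k : nat => discrete_topology 'Z_(m k)).

HB.instance Definition _ m := Topological.on (vilenkin_space m).
HB.instance Definition _ m :=
  isPointed.Build (vilenkin_space m) (fun k => 0 : 'Z_(m k)).

(* G_m with its Borel sigma-algebra. *)
Definition vilenkin (m : nat -> nat) :=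
  g_sigma_algebraType (@open (vilenkin_space m)).

Section VilenkinGroup.
Variable m : nat -> nat.
Implicit Types (x y : vilenkin m) (n k : nat).

Definition vadd x y : vilenkin m := fun k => (x k + y k : 'Z_(m k)).

Definition Mprod n : nat := (\prod_(k < n) m k)%N.

(* The digit n_k of n = \sum_k n_k M_k. *)
Definition digit n k : nat := ((n %/ Mprod k) %% m k)%N.

Definition cyl n x : set (vilenkin m) :=
  [set y | forall k, (k < n)%N -> y k = x k].

(* The generators of the n-th sigma-algebra of the filtration. *)
Definition cylinders n : set (set (vilenkin m)) := range (cyl n).

End VilenkinGroup.

Section VilenkinAnalysis.
Context {R : realType} {m : nat -> nat}.
Implicit Types (x y : vilenkin m) (n k : nat) (g : vilenkin m -> R[i])
  (f : nat -> vilenkin m -> R[i]) (p : R) (q : nat -> R).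

(* The normalization mu(G_m) = 1 is part of [probability]. *)
Definition haar (mu : probability (vilenkin m) R) : Prop :=
  forall (a : vilenkin m) (A : set (vilenkin m)),
    measurable A -> mu [set vadd a x | x in A] = mu A.

Definition cabs (z : R[i]) : R := complex.Re `|z|.

Definition rademacher k x : R[i] :=
  let t := 2 * pi * (nat_of_ord (x k))%:R / (m k)%:R in
  (cos t +i* sin t)%C.

(* The digits n_k with k >= n vanish, since n < 2 ^ n <= M_n when every m k is
   at least 2. *)
Definition psi n x : R[i] := \prod_(k < n) rademacher k x ^+ digit m n k.

Variable mu : probability (vilenkin m) R.

Definition cintegrable g : Prop :=
  mu.-integrable setT (EFin \o (@complex.Re R \o g)) /\
  mu.-integrable setT (EFin \o (@complex.Im R \o g)).

Definition cintegral (A : set (vilenkin m)) g : R[i] :=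
  (\int[mu]_(x in A) complex.Re (g x) +i*
   \int[mu]_(x in A) complex.Im (g x))%C.

Definition adapted f : Prop := forall n,
  measurable_fun [set: g_sigma_algebraType (@cylinders m n)]
    (@complex.Re R \o f n) /\
  measurable_fun [set: g_sigma_algebraType (@cylinders m n)]
    (@complex.Im R \o f n).

Definition martingale f : Prop :=
  [/\ adapted f, forall n, cintegrable (f n) &
      forall n k, (n <= k)%N -> forall A, <<s @cylinders m n >> A ->
        cintegral A (f k) = cintegral A (f n)].

Definition maximal f x : \bar R :=
  ereal_sup (range (fun n => (cabs (f n x))%:E)).

Definition Hp_norm p f : \bar R := Lnorm mu p%:E (maximal f).

Definition Hp p f : Prop := martingale f /\ (Hp_norm p f < +oo)%E.

(* R[i]^o is R[i] with the topology of its norm. *)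
Definition fourier_coef f (i : nat) : R[i] :=
  lim ((fun k => cintegral setT (fun x => f k x * (psi i x)^*) : R[i]^o) @ \oo).

Definition partial_sum f n x : R[i] :=
  \sum_(k < n) fourier_coef f k * psi k x.

Definition Qsum q n : R := \sum_(k < n) q k.

Definition Tmean q f n x : R[i] :=
  ((Qsum q n)^-1)%:C%C * \sum_(k < n) (q k)%:C%C * partial_sum f k x.

Definition Tweight p n : R :=
  n.+1%:R `^ (p^-1 - 2) * ln n.+1%:R ^ (2 * Num.floor (2^-1 + p)).

Definition Tmax p q f x : \bar R :=
  ereal_sup [set (cabs (Tmean q f n x) / Tweight p n)%:E
            | n in [set n | (0 < n)%N]].

End VilenkinAnalysis.

(* Main.v *)
(** Summation by parts bounds [T_n f] by the sums [A_n f] of the first [n]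
partial sums of [f]; the hypothesis on [q] makes the loss a constant.  For
[n < M_N] the kernel of [A_n] at [(x, t)] is at most a constant times the sum
over [k <= l < N] of [M_k M_l 1_(E_kl)(x, t)], where [E_kl(x, t)] says that [x]
and [t] agree in all coordinates [i < l] except possibly [i = k].  The integral
against [f_N] is a finite sum over cosets of level [N], so subadditivity of
[u |-> u ^ p] turns this, for [M_(N-1) <= n], into a bound of
[(|A_n f| / (n W_n)) ^ p] by [w_N^-1] times the sum over [k <= l < N] of
[(M_k M_l) ^ p] times the mean over [t] of [G_N(t) 1_(E_kl)(x, t)].  Here [W_n] is
the weight of the theorem, [G_N] is the running maximum of the [|f_n| ^ p], and
[w_N] is [1] for [p < 1/2] and [N + 1] for [p = 1/2].

It remains to bound the supremum over [N] of these averages in [L^1] by the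
integral of [sup_N G_N].  Write [G_N] as a telescoping sum of nonnegative [d_L],
[L <= N], with [d_L] measurable at level [L].  The part of the contribution of
[d_L] coming from [l < L] is controlled by [w_L^-1], the part with
[k < L <= l] is summable, and for [L <= k] the condition [E_kl(x, t)] forces
[d_L(t) = d_L(x)].  No atomic decomposition is needed. *)

Require Import Defs.
From mathcomp Require Import all_boot all_order all_algebra.
From mathcomp Require Import complex ring lra.
From mathcomp Require Import all_classical all_reals all_analysis.
From mathcomp Require Import measurable_realfun.
Import Order.TTheory GRing.Theory Num.Theory.
Import numFieldNormedType.Exports.

Local Open Scope classical_set_scope.
Local Open Scope ring_scope.

(** Euclidean division of the summation index by [M]. With [M = M_N] the quotient is the leading
    digit, which drives every induction on the level below. *)
Lemma sum_ord_mulnD (V : nmodType) (F : nat -> V) (a M r : nat) :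
  \sum_(i < a * M + r) F i =
  \sum_(u < a) \sum_(s < M) F (u * M + s)%N + \sum_(s < r) F (a * M + s)%N.
Proof.
rewrite big_split_ord /=; congr (_ + _).
elim: a => [|a IH]; first by rewrite !big_ord0.
by rewrite big_ord_recr /= -IH mulSnr big_split_ord.
Qed.

(** * Mixed radix digits *)

Section Digits.
Variable m : nat -> nat.
Hypothesis m_ge2 : forall k, (2 <= m k)%N.

Lemma m_gt0 k : (0 < m k)%N.
Proof. exact: ltnW. Qed.

Lemma Mprod0 : Mprod m 0 = 1%N.
Proof. by rewrite /Mprod big_ord0. Qed.

Lemma MprodS n : Mprod m n.+1 = (Mprod m n * m n)%N.
Proof. by rewrite /Mprod big_ord_recr. Qed.

Lemma Mprod_gt0 n : (0 < Mprod m n)%N.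
Proof. by elim: n => [|n IH]; rewrite ?Mprod0 // MprodS muln_gt0 IH m_gt0. Qed.

Lemma leq_Mprod k l : (k <= l)%N -> (2 ^ (l - k) * Mprod m k <= Mprod m l)%N.
Proof.
move=> kl; rewrite -{2}(subnK kl); elim: (l - k)%N => [|j IH].
  by rewrite expn0 mul1n.
by rewrite addSn MprodS expnSr mulnAC leq_mul.
Qed.

Lemma leq_Mprod_mono k l : (k <= l)%N -> (Mprod m k <= Mprod m l)%N.
Proof.
by move=> kl; apply: leq_trans (leq_Mprod _ _ kl); rewrite leq_pmull ?expn_gt0.
Qed.

Lemma expn2_Mprod n : (2 ^ n <= Mprod m n)%N.
Proof.
by have := leq_Mprod _ _ (leq0n n); rewrite subn0 Mprod0 muln1.
Qed.

Lemma ltn_Mprod n : (n < Mprod m n)%N.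
Proof. exact: leq_trans (ltn_expl _ _) (expn2_Mprod n). Qed.

Lemma digit_small n k : (n < Mprod m k)%N -> digit m n k = 0%N.
Proof. by move=> nk; rewrite /digit divn_small // mod0n. Qed.

Lemma digit_top N a s : (s < Mprod m N)%N -> (a < m N)%N ->
  digit m (a * Mprod m N + s) N = a.
Proof.
move=> sN am; rewrite /digit divnMDl ?Mprod_gt0 // divn_small // addn0.
exact: modn_small.
Qed.

(** For [i < N] the product [m_i M_i] divides [M_N], so adding a multiple of [M_N] leaves the [i]-th
    digit unchanged. *)
Lemma digit_low N a s i : (i < N)%N ->
  digit m (a * Mprod m N + s) i = digit m s i.
Proof.
move=> iN; have [c ->] : exists c, Mprod m N = (c * m i * Mprod m i)%N.
  exists (\prod_(i.+1 <= j < N) m j)%N; rewrite /Mprod -!(big_mkord xpredT m).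
  rewrite (big_cat_nat (n := i)) ?(ltnW iN) //= (big_ltn iN) mulnC.
  by congr muln; rewrite mulnC.
by rewrite /digit !mulnA divnMDl ?Mprod_gt0 // modnMDl.
Qed.

Lemma digit_ltn n k : (digit m n k < m k)%N.
Proof. by rewrite ltn_mod m_gt0. Qed.

(** Distributivity: [s < M_K] runs exactly once through all choices of [K] digits. The induction
    splits off the top digit. *)
Lemma sum_prod_digits (A : comNzSemiRingType) (a : nat -> nat -> A) K :
  \sum_(s < Mprod m K) \prod_(i < K) a i (digit m s i) =
  \prod_(i < K) \sum_(c < m i) a i c.
Proof.
elim: K => [|K IH]; first by rewrite Mprod0 big_ord1 !big_ord0.
rewrite [RHS]big_ord_recr /= -IH MprodS mulnC -[(_ * _)%N]addn0.
rewrite (sum_ord_mulnD A (fun s => \prod_(i < K.+1) a i (digit m s i))).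
rewrite [X in _ + X]big_ord0 addr0 mulr_sumr.
apply: eq_bigr => c _; rewrite mulr_suml; apply: eq_bigr => s _.
rewrite big_ord_recr /= digit_top //; congr (_ * _).
by apply: eq_bigr => i _; rewrite digit_low.
Qed.

End Digits.

(** * The Fejer kernel *)

Section Kernel.
Variables (m : nat -> nat) (B : nat) (C : numDomainType).
Hypotheses (m_ge2 : forall k, (2 <= m k)%N) (m_le : forall k, (m k <= B)%N).
Variables (z : nat -> C) (e : nat -> bool).
Hypotheses (z_le1 : forall k, `|z k| <= 1)
  (sum_z : forall k, \sum_(u < m k) z k ^+ u = if e k then (m k)%:R else 0).
Local Notation M := (Mprod m).

(** [char_prod], [dirichlet] and [dirichlet_sum] become [psi_n(x) conj(psi_n(t))],
the Dirichlet kernel and [n] times the Fejer kernel when [z k] is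
[r_k(x) conj(r_k(t))] and [e k] means [x_k = t_k]. *)
Definition char_prod n : C := \prod_(k < n) z k ^+ digit m n k.
Definition dirichlet j : C := \sum_(i < j) char_prod i.
Definition dirichlet_sum n : C := \sum_(j < n) dirichlet j.
(** The event [E_kl]. For [k = l] the exception falls outside the range, so [agree l l] is plain
    agreement in the first [l] coordinates. *)
Definition agree k l : bool := [forall i : 'I_l, (i == k :> nat) || e i].

(** Digits beyond the length of [n] vanish, so both products equal the one of length [maxn n K]. *)
Lemma char_prod_widen n K : (n < M K)%N ->
  char_prod n = \prod_(k < K) z k ^+ digit m n k.
Proof.
have widen a b : (a <= b)%N -> (n < M a)%N ->
    \prod_(k < b) z k ^+ digit m n k = \prod_(k < a) z k ^+ digit m n k.
  move=> ab na; rewrite -!(big_mkord xpredT (fun k => z k ^+ digit m n k)).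
  rewrite (big_cat_nat (n := a)) //= [X in _ * X]big_nat_cond.
  rewrite [X in _ * X]big1 ?mulr1 // => k /andP[/andP[ak _] _].
  by rewrite digit_small ?expr0 // (leq_trans na) // leq_Mprod_mono.
move=> nK; rewrite /char_prod -(widen n (maxn n K)) ?leq_maxl ?ltn_Mprod //.
by rewrite (widen K) // leq_maxr.
Qed.

Lemma char_prod_top N a s : (s < M N)%N -> (a < m N)%N ->
  char_prod (a * M N + s) = z N ^+ a * char_prod s.
Proof.
move=> sN aN; rewrite (@char_prod_widen _ N.+1); last first.
  rewrite MprodS [ltnRHS]mulnC (leq_trans _ (leq_mul aN (leqnn (M N)))) //.
  by rewrite mulSn addnC ltn_add2r.
rewrite big_ord_recr /= digit_top // mulrC (char_prod_widen _ _ sN).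
by congr (_ * _); apply: eq_bigr => i _; rewrite digit_low.
Qed.

(** The [u]-th block of [M_N] consecutive indices has leading digit [u] and contributes [z_N ^ u]
    times the full Dirichlet kernel of level [N]. *)
Lemma dirichlet_top N a r : (r <= M N)%N -> (a < m N)%N ->
  dirichlet (a * M N + r) =
  (\sum_(u < a) z N ^+ u) * dirichlet (M N) + z N ^+ a * dirichlet r.
Proof.
move=> rN aN; rewrite /dirichlet sum_ord_mulnD mulr_suml mulr_sumr.
congr (_ + _).
  apply: eq_bigr => u _; rewrite mulr_sumr; apply: eq_bigr => s _.
  by rewrite char_prod_top // (ltn_trans _ aN).
by apply: eq_bigr => s _; rewrite char_prod_top // (leq_trans _ rN).
Qed.

Lemma agree_diag N : agree N N.+1 = agree N N.
Proof.
apply/forallP/forallP => H i.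
  by have := H (widen_ord (leqnSn N) i).
have [iN|] := ltnP i N; first by have := H (Ordinal iN).
by move=> Ni; rewrite eqn_leq Ni -ltnS ltn_ord.
Qed.

Lemma agreeS k N : (k < N)%N -> agree k N.+1 = agree k N && e N.
Proof.
move=> kN; apply/forallP/andP => [H|[/forallP H eN] i].
  split; last by have := H ord_max; rewrite /= gtn_eqF.
  by apply/forallP => i; have := H (widen_ord (leqnSn N) i).
have [iN|Ni] := ltnP i N; first by have := H (Ordinal iN).
by have -> : i = N :> nat by [apply/eqP; rewrite eqn_leq Ni -ltnS ltn_ord];
  rewrite eN orbT.
Qed.

Lemma agreeSS N : agree N.+1 N.+1 = agree N N && e N.
Proof.
apply/forallP/andP => [H|[/forallP H eN] i].
  split; last by have := H ord_max; rewrite /= ltn_eqF.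
  apply/forallP => i; have := H (widen_ord (leqnSn N) i).
  by rewrite /= !ltn_eqF // ltnW // ltnS.
have [iN|Ni] := ltnP i N.
  by have := H (Ordinal iN); rewrite /= !ltn_eqF // ltnW.
by have -> : i = N :> nat by [apply/eqP; rewrite eqn_leq Ni -ltnS ltn_ord];
  rewrite eN orbT.
Qed.

(** Paley's formula [D_(M_N) = M_N 1_(I_N)]: passing to the next level multiplies the kernel by
    [\sum_u z_N ^ u], which is [m_N] or [0]. *)
Lemma dirichlet_Mprod N : dirichlet (M N) = (M N)%:R * (agree N N)%:R.
Proof.
elim: N => [|N IH].
  rewrite Mprod0 /dirichlet big_ord1 /char_prod big_ord0 mul1r.
  by rewrite (_ : agree 0 0) //; apply/forallP => -[].
have -> : dirichlet (M N.+1) = (\sum_(u < m N) z N ^+ u) * dirichlet (M N).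
  rewrite /dirichlet MprodS mulnC -[(_ * _)%N]addn0 sum_ord_mulnD.
  rewrite [X in _ + X]big_ord0 addr0 mulr_suml.
  apply: eq_bigr => u _; rewrite mulr_sumr; apply: eq_bigr => s _.
  by rewrite char_prod_top.
rewrite sum_z IH agreeSS MprodS natrM.
by case: (e N); rewrite ?andbT ?andbF ?mul0r ?mulr0 // mulrA (mulrC (M N)%:R).
Qed.

Lemma sum_pow_le k u : `|\sum_(v < u) z k ^+ v| <= u%:R.
Proof.
apply: le_trans (ler_norm_sum _ _ _) _.
rewrite -[X in _ <= X%:R]card_ord -sumr_const.
by apply: ler_sum => v _; rewrite normrX exprn_ile1.
Qed.

(** [dirichlet_top] summed over complete blocks. The remainder stays unexpanded so that [a = m N],
    [r = 0] is covered, which is the passage from [M_N] to [M_(N+1)]. *)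
Lemma dirichlet_sum_top N a r : (r <= M N)%N -> (a <= m N)%N ->
  dirichlet_sum (a * M N + r) =
  (\sum_(u < a) \sum_(v < u) z N ^+ v) * ((M N)%:R * dirichlet (M N)) +
  (\sum_(u < a) z N ^+ u) * dirichlet_sum (M N) +
  \sum_(s < r) dirichlet (a * M N + s).
Proof.
move=> rN aN; rewrite /dirichlet_sum sum_ord_mulnD; congr (_ + _).
rewrite [in RHS]mulr_suml [X in _ + X]mulr_suml -big_split /=. apply: eq_bigr => u _.
transitivity (\sum_(s < M N) ((\sum_(v < u) z N ^+ v) * dirichlet (M N)
    + z N ^+ u * dirichlet s)).
  by apply: eq_bigr => s _; rewrite dirichlet_top ?(leq_trans _ aN) // ltnW.
rewrite big_split /= sumr_const card_ord -mulr_sumr; congr (_ + _).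
by rewrite mulr_natl mulrnAr.
Qed.

Lemma B_ge1 : 1 <= B%:R :> C.
Proof. by rewrite ler1n (leq_trans _ (m_le 0)) // ltnW. Qed.

Lemma sum_sum_pow_le k a : (a <= m k)%N ->
  `|\sum_(u < a) \sum_(v < u) z k ^+ v| <= B%:R ^+ 2.
Proof.
move=> am; apply: le_trans (ler_norm_sum _ _ _) _.
have aB : (a <= B)%N by exact: leq_trans (m_le k).
apply: (@le_trans _ _ (\sum_(u < a) B%:R)).
  apply: ler_sum => u _; apply: le_trans (sum_pow_le _ _) _.
  by rewrite ler_nat (leq_trans _ aB) // ltnW.
by rewrite sumr_const card_ord expr2 -[leLHS]mulr_natr ler_wpM2l ?ler_nat.
Qed.

(** Passing from [M_N] to [M_(N+1)] multiplies the sum by [\sum_u z_N ^ u], which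
vanishes unless [e N]: this is why only one coordinate may disagree. *)
Lemma dirichlet_sum_Mprod N : `|dirichlet_sum (M N)| <=
  B%:R ^+ 2 * \sum_(k < N) (M k * M N)%:R * (agree k N)%:R.
Proof.
elim: N => [|N IH].
  by rewrite Mprod0 /dirichlet_sum big_ord1 /dirichlet !big_ord0 normr0 mulr0.
rewrite [in leLHS]MprodS mulnC -[(_ * _)%N]addn0 dirichlet_sum_top //.
rewrite big_ord0 addr0 sum_z (le_trans (ler_normD _ _)) //.
rewrite big_ord_recr /= mulrDr addrC lerD //.
  case eN : (e N); last first.
    by rewrite mul0r normr0 mulr_ge0 ?exprn_ge0 ?sumr_ge0 // => k _; rewrite mulr_ge0.
  rewrite normrM normr_nat (le_trans (ler_wpM2l _ IH)) // mulrCA ler_wpM2l //.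
  rewrite mulr_sumr ler_sum // => k _.
  by rewrite agreeS // eN andbT MprodS mulrA -(natrM _ (m N)) mulnCA [(m N * _)%N]mulnC.
(* The double sum of powers produces the new summand [k = N], in which coordinate [N] is left
   free. *)
rewrite normrM ler_pM //; first exact: sum_sum_pow_le.
rewrite dirichlet_Mprod agree_diag mulrA -natrM ger0_norm ?mulr_ge0 //.
by rewrite ler_wpM2r // ler_nat leq_mul // leq_Mprod_mono.
Qed.

(** Induction on the level through [n = a M_N + r]: the summand with factor [dirichlet_sum r] is
    left to the induction hypothesis, and all others fit into the summand [l = N]. *)
Lemma dirichlet_sum_le N n : (n < M N)%N -> `|dirichlet_sum n| <=
  2 * B%:R ^+ 3 *
  \sum_(l < N) \sum_(k < l.+1) (M k * M l)%:R * (agree k l)%:R.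
Proof.
elim: N n => [|N IH] n.
  rewrite Mprod0 ltnS leqn0 => /eqP ->.
  by rewrite /dirichlet_sum !big_ord0 normr0 mulr0.
rewrite MprodS => nN.
have rN : (n %% M N < M N)%N by rewrite ltn_mod Mprod_gt0.
have aN : (n %/ M N < m N)%N by rewrite ltn_divLR ?Mprod_gt0 // mulnC.
rewrite (divn_eq n (M N)); set a := (n %/ M N)%N in aN *.
set r := (n %% M N)%N in rN *.
rewrite dirichlet_sum_top ?(ltnW aN) ?(ltnW rN) //.
(* The incomplete last block has leading digit [a < m N], so [dirichlet_top] applies to it. *)
have -> : \sum_(s < r) dirichlet (a * M N + s) =
    (\sum_(u < a) z N ^+ u) * (r%:R * dirichlet (M N)) + z N ^+ a * dirichlet_sum r.
  transitivity (\sum_(s < r) ((\sum_(u < a) z N ^+ u) * dirichlet (M N)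
      + z N ^+ a * dirichlet s)).
    apply: eq_bigr => s _.
    by rewrite dirichlet_top // ltnW // (ltn_trans _ rN).
  by rewrite big_split /= sumr_const card_ord -mulr_sumr mulr_natl mulrnAr.
rewrite big_ord_recr /= mulrDr.
rewrite addrA (le_trans (ler_normD _ _)) // [leRHS]addrC.
rewrite lerD //; last first.
  rewrite normrM (le_trans _ (IH r rN)) // ler_piMl // normrX exprn_ile1 //.
set S := \sum_(k < N) (M k * M N)%:R * (agree k N)%:R : C.
set T := (M N * M N)%:R * (agree N N)%:R : C.
have T0 : 0 <= T by rewrite mulr_ge0.
have S0 : 0 <= S by rewrite sumr_ge0 // => k _; rewrite mulr_ge0.
rewrite big_ord_recr /= -/S -/T.
have b1 := B_ge1; have b0 : 0 <= B%:R :> C by [].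
have aB : a%:R <= B%:R :> C by rewrite ler_nat (leq_trans (ltnW aN)).
have phi_le : `|\sum_(u < a) z N ^+ u| <= B%:R.
  exact: le_trans (sum_pow_le _ _) aB.
have h1 : `|(\sum_(u < a) \sum_(v < u) z N ^+ v) * ((M N)%:R * dirichlet (M N))|
    <= B%:R ^+ 3 * T.
  rewrite normrM dirichlet_Mprod mulrA -natrM -/T (ger0_norm T0).
  rewrite ler_wpM2r // (le_trans (sum_sum_pow_le _ _ (ltnW aN))) //.
  by rewrite exprS ler_peMl ?exprn_ge0.
have h2 : `|(\sum_(u < a) z N ^+ u) * dirichlet_sum (M N)| <= B%:R ^+ 3 * S.
  by rewrite normrM exprS -mulrA ler_pM // dirichlet_sum_Mprod.
have h3 : `|(\sum_(u < a) z N ^+ u) * (r%:R * dirichlet (M N))| <= B%:R ^+ 3 * T.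
  rewrite normrM ler_pM //.
    by rewrite (le_trans phi_le) // exprS ler_peMr // exprn_ege1.
  rewrite dirichlet_Mprod mulrA -natrM ger0_norm ?mulr_ge0 // ler_wpM2r //.
  by rewrite ler_nat leq_mul // ltnW.
(* The diagonal term [T] occurs twice, once from the complete blocks and once from the incomplete
   one: hence the factor [2] in the constant. *)
apply: (@le_trans _ _ (B%:R ^+ 3 * T + B%:R ^+ 3 * S + B%:R ^+ 3 * T)).
  rewrite (le_trans (ler_normD _ _)) // lerD // (le_trans (ler_normD _ _)) //.
  exact: lerD.
rewrite -!mulrDr -mulrA mulrCA ler_wpM2l ?exprn_ge0 //.
by rewrite mulr_natl mulr2n [T + S]addrC lerD2l lerDr.
Qed.

End Kernel.

Lemma prod_boolr (A : comNzSemiRingType) (I : finType) (P : pred I) :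
  \prod_(i : I) (P i)%:R = ([forall i, P i])%:R :> A.
Proof.
case: forallP => [H|/forallP]; first by rewrite big1 // => i _; rewrite H.
by rewrite negb_forall => /existsP[i /negbTE nPi]; rewrite (bigD1 i) //= nPi mul0r.
Qed.

(** * Averages over cosets *)

Section Points.
Variables (m : nat -> nat) (B : nat).
Hypotheses (m_ge2 : forall k, (2 <= m k)%N) (m_le : forall k, (m k <= B)%N).
Local Notation M := (Mprod m).
Implicit Types (x y t : vilenkin m).

Definition vcoord x k : nat := nat_of_ord (x k).

(** The points [pt s], [s < M_N], represent the cosets of level [N]. *)
Definition pt s : vilenkin m := fun k => inZp (digit m s k) : 'Z_(m k).

Definition agr k l x t : bool := agree (fun i => vcoord x i == vcoord t i) k l.

Lemma coord_inj x y k : vcoord x k = vcoord y k -> x k = y k.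
Proof. exact: val_inj. Qed.

Lemma coord_ltn x k : (vcoord x k < m k)%N.
Proof. by apply: leq_trans (ltn_ord (x k)) _; rewrite Zp_cast. Qed.

Lemma coord_pt s k : vcoord (pt s) k = digit m s k.
Proof. by rewrite /vcoord /pt /= Zp_cast // modn_small // digit_ltn. Qed.

Lemma agr_sym k l x t : agr k l x t = agr k l t x.
Proof. by apply/forallP/forallP => H i; rewrite [vcoord _ _ == _]eq_sym; exact: H. Qed.

Lemma agrP k l x t :
  reflect (forall i, (i < l)%N -> i != k -> x i = t i) (agr k l x t).
Proof.
apply: (iffP forallP) => [H i il ik|H i].
  by apply: coord_inj; have /= := H (Ordinal il); rewrite (negbTE ik) => /eqP.
by case: eqVneq => //= ik; rewrite /vcoord H.
Qed.

Lemma agr_diagP N x t :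
  reflect (forall i, (i < N)%N -> x i = t i) (agr N N x t).
Proof.
apply: (iffP (agrP _ _ _ _)) => H i iN; last by move=> _; exact: H.
by apply: H => //; rewrite ltn_eqF.
Qed.

(** Writing the indicator as a product over coordinates makes [sum_prod_digits] count the related
    cosets. *)
Lemma agrE (A : comNzSemiRingType) k l K x t : (l <= K)%N ->
  (agr k l x t)%:R =
  \prod_(i < K) ([|| (l <= i)%N, i == k :> nat | vcoord x i == vcoord t i])%:R :> A.
Proof.
move=> lK; rewrite prod_boolr; congr ((nat_of_bool _)%:R).
apply/forallP/forallP => H i.
  by have [//|il] := leqP l i; have := H (Ordinal il).
by have := H (widen_ord lK i); rewrite /= leqNgt ltn_ord.
Qed.

Lemma sum_agr k l K x : (l <= K)%N ->
  (\sum_(s < M K) agr k l x (pt s) =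
   \prod_(i < K) (if (l <= i) || (i == k :> nat) then m i else 1))%N.
Proof.
move=> lK.
transitivity (\sum_(s < M K) \prod_(i < K)
    (fun i c => nat_of_bool [|| (l <= i)%N, i == k | vcoord x i == c]) i (digit m s i))%N.
  apply: eq_bigr => s _; rewrite -[LHS]natn (@agrE _ _ _ K) //.
  by apply: eq_bigr => i _; rewrite natn coord_pt.
rewrite [LHS](sum_prod_digits m m_ge2 nat
  (fun i c => nat_of_bool [|| (l <= i)%N, i == k | vcoord x i == c])).
apply: eq_bigr => i _ /=.
case: (l <= i)%N => /=; first by rewrite sum1_card card_ord.
case: (_ == _) => /=; first by rewrite sum1_card card_ord.
rewrite (bigD1 (Ordinal (coord_ltn x i))) //= eqxx big1 // => c.
by rewrite -val_eqE /= eq_sym => /negbTE ->.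
Qed.

Lemma sum_agr_diag K x : (\sum_(s < M K) agr K K x (pt s) = 1)%N.
Proof.
by rewrite sum_agr // big1 // => i _; rewrite leqNgt ltn_ord /= ltn_eqF.
Qed.

(** The free coordinates [i >= l] account for [M_K / M_l] choices and the exceptional coordinate [k]
    for at most [B]; the bound is multiplied out to stay in [nat]. *)
Lemma sum_agr_le k l K x : (l <= K)%N ->
  ((\sum_(s < M K) agr k l x (pt s)) * M l <= B * M K)%N.
Proof.
move=> lK; rewrite sum_agr // /Mprod (big_ord_widen _ _ lK).
rewrite [X in (_ * X <= _)%N]big_mkcond -big_split /=.
have B0 : (0 < B)%N by rewrite (leq_trans _ (m_le 0)) // ltnW.
apply: (@leq_trans (\prod_(i < K) ((if i == k :> nat then B else 1) * m i))%N).
  apply: leq_prod => i _; rewrite [(l <= i)%N]leqNgt.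
  case: (i < l)%N => /=; last by rewrite muln1; case: eqP; rewrite ?mul1n // leq_pmull.
  by case: eqP => // _; rewrite leq_mul2r m_le orbT.
rewrite big_split /= leq_mul2r; apply/orP; right.
have [kK|Kk] := ltnP k K.
  rewrite (bigD1 (Ordinal kK)) //= eqxx big1 ?muln1 // => i.
  by rewrite -val_eqE /= => /negbTE ->.
rewrite big1 // => i _; rewrite ltn_eqF //; exact: leq_trans Kk.
Qed.

(** Measurability at level [N], in a pointwise form that makes sense for values of any type. *)
Definition cylindrical {T} N (g : vilenkin m -> T) :=
  forall x y, (forall k, (k < N)%N -> x k = y k) -> g x = g y.

Lemma cylindrical_le T N K (g : vilenkin m -> T) : (N <= K)%N ->
  cylindrical N g -> cylindrical K g.
Proof. by move=> NK gN x y xy; apply: gN => k kN; apply: xy; exact: leq_trans NK. Qed.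

(** On functions of level [N] this is the Haar integral, by [integral_cylindrical]. As a finite sum
    it makes Fubini a mere exchange of sums. *)
Definition avg {F : numFieldType} N (g : vilenkin m -> F) : F :=
  (M N)%:R^-1 * \sum_(s < M N) g (pt s).

Section Avg.
Variable F : numFieldType.
Implicit Types g h : vilenkin m -> F.

Lemma M_neq0 N : (M N)%:R != 0 :> F.
Proof. by rewrite pnatr_eq0 -lt0n Mprod_gt0. Qed.

Lemma M_gt0 N : 0 < (M N)%:R :> F.
Proof. by rewrite ltr0n Mprod_gt0. Qed.

Lemma eq_avg N g h : g =1 h -> avg N g = avg N h.
Proof. by move=> gh; congr (_ * _); apply: eq_bigr => s _. Qed.

Lemma avgZ N c g : avg N (fun x => c * g x) = c * avg N g.
Proof. by rewrite /avg -mulr_sumr mulrCA. Qed.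

Lemma avg_sum N I (r : seq I) P (g : I -> vilenkin m -> F) :
  avg N (fun x => \sum_(i <- r | P i) g i x) = \sum_(i <- r | P i) avg N (g i).
Proof. by rewrite /avg exchange_big mulr_sumr. Qed.

Lemma avgD N g h : avg N (fun x => g x + h x) = avg N g + avg N h.
Proof. by rewrite /avg big_split mulrDr. Qed.

Lemma avg_exchange N (g : vilenkin m -> vilenkin m -> F) :
  avg N (fun x => avg N (g x)) = avg N (fun t => avg N (g^~ t)).
Proof. by rewrite /avg -!mulr_sumr exchange_big. Qed.

Lemma ler_avg N g h : (forall x, g x <= h x) -> avg N g <= avg N h.
Proof. by move=> gh; rewrite ler_wpM2l ?invr_ge0 // ler_sum. Qed.

Lemma avg_ge0 N g : (forall x, 0 <= g x) -> 0 <= avg N g.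
Proof. by move=> g0; rewrite mulr_ge0 ?invr_ge0 // sumr_ge0. Qed.

Lemma ler_norm_avg N g : `|avg N g| <= avg N (fun x => `|g x|).
Proof.
by rewrite /avg normrM normfV normr_nat ler_wpM2l ?invr_ge0 // ler_norm_sum.
Qed.

(** Exactly one representative [pt s] lies in the coset of [x]. *)
Lemma cylindrical_sum_agr N g x : cylindrical N g ->
  \sum_(s < M N) (agr N N x (pt s))%:R * g (pt s) = g x.
Proof.
move=> gN; transitivity (\sum_(s < M N) (agr N N x (pt s))%:R * g x).
  apply: eq_bigr => s _; case: agr_diagP => H; last by rewrite !mul0r.
  by rewrite (gN _ _ H).
by rewrite -mulr_suml -natr_sum sum_agr_diag mul1r.
Qed.

(** Each coset of level [L] splits into [m L] cosets of level [L + 1], on all of which [g] takes the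
    same value. *)
Lemma avg_cylindrical N K g : (N <= K)%N -> cylindrical N g ->
  avg K g = avg N g.
Proof.
move=> NK gN; rewrite -(subnK NK); elim: (K - N)%N => // j IH.
rewrite addSn -IH; set L := (j + N)%N.
have gL : cylindrical L g by apply: cylindrical_le gN; exact: leq_addl.
rewrite /avg MprodS mulnC -[(_ * _)%N]addn0 (sum_ord_mulnD _ (g \o pt)).
rewrite [X in _ + X]big_ord0 addr0.
rewrite (eq_bigr (fun _ => \sum_(s < M L) g (pt s))); last first.
  move=> u _; apply: eq_bigr => s _ /=; apply: gL => k kL.
  by apply: coord_inj; rewrite !coord_pt digit_low.
rewrite sumr_const card_ord addn0 -[X in _ * X]mulr_natl natrM invfM mulrAC.
rewrite mulrA mulVf ?mul1r 1?mulrC // pnatr_eq0 -lt0n; exact: m_gt0.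
Qed.

Lemma avg_agr_le k l K x : (l <= K)%N ->
  avg K (fun t => (agr k l x t)%:R) <= B%:R / (M l)%:R :> F.
Proof.
move=> lK; rewrite /avg -natr_sum mulrC ler_pdivrMr ?M_gt0 // mulrAC.
by rewrite ler_pdivlMr ?M_gt0 // -!natrM ler_nat sum_agr_le.
Qed.

End Avg.
End Points.
Arguments avg {m F} N g.

(** * The maximal estimate *)

Section Geometric.
Variables (R : numFieldType) (rho : R).
Hypotheses (rho_ge0 : 0 <= rho) (rho_lt1 : rho < 1).
Local Notation g := (1 - rho)^-1.

Lemma geom_ge0 : 0 <= g.
Proof. by rewrite invr_ge0 subr_ge0 ltW. Qed.

Lemma sum_geom_le n : \sum_(0 <= i < n) rho ^+ i <= g.
Proof.
rewrite big_mkord -[leRHS]mul1r ler_pdivlMr ?subr_gt0 //.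
by rewrite mulrC -opprB mulNr -subrX1 opprB gerBl exprn_ge0.
Qed.

Lemma sum_geom_rev_le l : \sum_(0 <= k < l.+1) rho ^+ (l - k) <= g.
Proof.
rewrite big_mkord (reindex_inj rev_ord_inj) /=.
rewrite (eq_bigr (fun i : 'I_l.+1 => rho ^+ i)) => [|i _].
  by rewrite -(big_mkord xpredT (fun i => rho ^+ i)) sum_geom_le.
by rewrite subSS subKn // -ltnS.
Qed.

Lemma sum_geom_tail_le L l : (L <= l)%N ->
  \sum_(L <= k < l.+1) rho ^+ (l - k) <= g.
Proof.
move=> Ll; apply: le_trans (sum_geom_rev_le l).
rewrite [leRHS](big_cat_nat (n := L)) ?(leq_trans Ll) //= lerDr.
by rewrite sumr_ge0 // => k _; exact: exprn_ge0.
Qed.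

(** For [k < L <= l] the power [rho ^ (l - k)] factors through [L], so the double sum is a product
    of two geometric sums. *)
Lemma sum_geom_cross_le L K :
  \sum_(L <= l < K) \sum_(0 <= k < L) rho ^+ (l - k) <= g ^+ 2.
Proof.
rewrite (eq_big_nat _ _ (F2 := fun l => rho ^+ (l - L) *
    \sum_(0 <= k < L) rho ^+ (L - k))) => [|l /andP[Ll _]]; last first.
  rewrite mulr_sumr; apply: eq_big_nat => k /andP[_ kL].
  by rewrite -exprD addnBA ?(ltnW kL) // subnK.
rewrite -mulr_suml expr2; apply: ler_pM.
- by rewrite sumr_ge0 // => l _; exact: exprn_ge0.
- by rewrite sumr_ge0 // => l _; exact: exprn_ge0.
- rewrite -{1}[L]add0n big_addn (eq_bigr (fun i => rho ^+ i)) ?sum_geom_le //.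
  by move=> i _; rewrite addnK.
- by apply: le_trans (sum_geom_rev_le L); rewrite big_nat_recr //= lerDl exprn_ge0.
Qed.

End Geometric.

(** * Maximal inequality for weighted sums of shifted averages *)

Section Domination.
Variables (R : realFieldType) (m : nat -> nat) (B : nat).
Hypotheses (m_ge2 : forall k, (2 <= m k)%N) (m_le : forall k, (m k <= B)%N).
Local Notation M := (Mprod m).
Variables (rho tau D E : R) (b : nat -> nat -> R) (w : nat -> R).
Hypotheses (rho_ge0 : 0 <= rho) (rho_lt1 : rho < 1).
Hypotheses (tau_ge0 : 0 <= tau) (tau_le1 : tau <= 1) (D_ge0 : 0 <= D).
Hypotheses (b_ge0 : forall k l, 0 <= b k l)
  (b_le : forall k l, (k <= l)%N ->
    b k l * (B%:R / (M l)%:R) <= D * rho ^+ (l - k) * tau ^+ l).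
Hypotheses (w_ge1 : forall N, 1 <= w N) (w_le : {homo w : N K / (N <= K)%N >-> N <= K})
  (sum_tau : forall N, \sum_(0 <= l < N) tau ^+ l <= E * w N).
Local Notation g := (1 - rho)^-1.

(** [K] is a level at which everything in sight is measurable, so that [avg K] is
the Haar integral. *)
Definition shift_avg K (d : vilenkin m -> R) k l x :=
  b k l * avg K (fun t => d t * (agr m k l x t)%:R).

Definition shift_sum K N d x :=
  (w N)^-1 * \sum_(0 <= l < N) \sum_(0 <= k < l.+1) shift_avg K d k l x.

Let w_gt0 N : 0 < w N. Proof. exact: lt_le_trans (w_ge1 N). Qed.
Let g_ge0 : 0 <= g. Proof. exact: geom_ge0. Qed.
Let E_ge0 : 0 <= E.
Proof. by have := sum_tau 0; rewrite big_nil pmulr_lge0. Qed.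

Lemma shift_avg_ge0 K d k l x : (forall t, 0 <= d t) -> 0 <= shift_avg K d k l x.
Proof. by move=> d0; rewrite mulr_ge0 ?avg_ge0 // => t; rewrite mulr_ge0. Qed.

(** After exchanging the two averages, symmetry of [agr] shows that each [t] is related to a set of
    [x] of measure at most [B / M_l]. *)
Lemma avg_shift_avg_le K d k l : (forall t, 0 <= d t) -> (k <= l <= K)%N ->
  avg K (shift_avg K d k l) <= D * rho ^+ (l - k) * tau ^+ l * avg K d.
Proof.
move=> d0 /andP[kl lK]; rewrite /shift_avg avgZ avg_exchange.
apply: (@le_trans _ _ (b k l * avg K (fun t => B%:R / (M l)%:R * d t))).
  rewrite ler_wpM2l // ler_avg // => t; rewrite avgZ mulrC ler_wpM2r //.
  rewrite (@eq_avg _ _ _ _ (fun x => (agr m k l t x)%:R)); last first.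
    by move=> x; rewrite agr_sym.
  exact: avg_agr_le.
by rewrite avgZ mulrA ler_wpM2r ?avg_ge0 // b_le.
Qed.

(** When [L <= k], related points agree in all coordinates below [L], so [d t = d x] leaves the
    average. The resulting bound is pointwise. *)
Lemma shift_avg_local_le K L d k l x : (forall t, 0 <= d t) ->
  cylindrical m L d -> (L <= k <= l)%N -> (l <= K)%N ->
  shift_avg K d k l x <= D * rho ^+ (l - k) * tau ^+ l * d x.
Proof.
move=> d0 dL /andP[Lk kl] lK; rewrite /shift_avg.
rewrite (@eq_avg _ _ _ _ (fun t => d x * (agr m k l x t)%:R)); last first.
  move=> t; case: (agrP m k l x t) => [H|]; rewrite ?mulr0 // (dL x t) // => i iL.
  by apply: H; [exact: leq_trans (leq_trans Lk kl)|rewrite ltn_eqF // (leq_trans iL)].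
rewrite avgZ mulrCA mulrC ler_wpM2r // (le_trans _ (b_le _ _ kl)) //.
by rewrite ler_wpM2l // avg_agr_le.
Qed.

Lemma shift_sum_local K L d : (L <= K)%N -> (forall t, 0 <= d t) ->
  cylindrical m L d ->
  exists H : vilenkin m -> R,
    (forall N x, (L <= N <= K)%N -> shift_sum K N d x <= H x) /\
    avg K H <= (2 * (D * g * E) + D * g ^+ 2) * avg K d.
Proof.
move=> LK d0 dL; pose a := shift_avg K d.
have a0 k l x : 0 <= a k l x by exact: shift_avg_ge0.
have ad0 : 0 <= avg K d by exact: avg_ge0.
(* The three terms cover [l < L], [k < L <= l] and [L <= k]. None depends on [N]: [w] is monotone
   and at least [1], and in the last range the weight is cancelled. *)
exists (fun x => (w L)^-1 * (\sum_(0 <= l < L) \sum_(0 <= k < l.+1) a k l x) +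
  \sum_(L <= l < K) \sum_(0 <= k < L) a k l x + D * g * E * d x).
split.
  move=> N x /andP[LN NK]; rewrite /shift_sum -/a.
  rewrite (big_cat_nat (n := L)) //= mulrDr -[leRHS]addrA lerD //.
    rewrite ler_wpM2r ?lef_pV2 ?posrE ?w_le // sumr_ge0 // => l _.
    exact: sumr_ge0.
  rewrite (eq_big_nat _ _ (F2 := fun l => \sum_(0 <= k < L) a k l x +
      \sum_(L <= k < l.+1) a k l x)) => [|l /andP[Ll _]]; last first.
    by rewrite (big_cat_nat (n := L)) ?(leq_trans Ll).
  rewrite big_split mulrDr lerD //=.
    have S0 P Q : 0 <= \sum_(P <= l < Q) \sum_(0 <= k < L) a k l x.
      by rewrite sumr_ge0 // => l _; exact: sumr_ge0.
    apply: (@le_trans _ _ (\sum_(L <= l < N) \sum_(0 <= k < L) a k l x)).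
      by rewrite ler_piMl // invf_le1.
    by rewrite [leRHS](big_cat_nat (n := N)) //= lerDl.
  (* Range [L <= k]: the sum over [k] costs [g] and the sum over [l] costs [E * w N], which the
     weight absorbs. *)
  rewrite mulrC ler_pdivrMr //.
  apply: (@le_trans _ _ (\sum_(L <= l < N) D * g * d x * tau ^+ l)).
    rewrite !big_nat ler_sum // => l /andP[Ll lN].
    apply: (@le_trans _ _
        (\sum_(L <= k < l.+1) D * d x * tau ^+ l * rho ^+ (l - k))).
      rewrite !big_nat ler_sum // => k /andP[Lk kl].
      apply: le_trans (shift_avg_local_le _ _ _ _ _ _ d0 dL _ _) _.
      - by rewrite Lk -ltnS.
      - by rewrite ltnW // (leq_trans lN).
      - by rewrite le_eqVlt; apply/orP; left; apply/eqP; ring.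
    have -> : D * g * d x * tau ^+ l = D * d x * tau ^+ l * g by ring.
    rewrite -mulr_sumr ler_wpM2l ?mulr_ge0 ?exprn_ge0 //.
    exact: sum_geom_tail_le.
  have -> : D * g * E * d x * w N = D * g * d x * (E * w N) by ring.
  rewrite -mulr_sumr ler_wpM2l ?mulr_ge0 // (le_trans _ (sum_tau N)) //.
  rewrite [leRHS](big_cat_nat (n := L)) //= lerDr sumr_ge0 // => l _.
  exact: exprn_ge0.
(* The first and third terms of the majorant contribute [D * g * E] each, the middle one
   [D * g ^+ 2]. *)
rewrite !avgD !avgZ avg_sum mulrDl mulr_natl mulr2n mulrDl.
rewrite -[leRHS]addrA [X in _ <= _ + X]addrC [leRHS]addrA lerD // lerD //.
  rewrite mulrC ler_pdivrMr //.
  apply: (@le_trans _ _ (\sum_(0 <= l < L) D * g * avg K d * tau ^+ l)).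
    rewrite !big_nat ler_sum // => l /andP[_ lL]; rewrite avg_sum.
    apply: (@le_trans _ _
        (\sum_(0 <= k < l.+1) D * avg K d * tau ^+ l * rho ^+ (l - k))).
      rewrite !big_nat ler_sum // => k /andP[_ kl].
      apply: le_trans (avg_shift_avg_le _ _ _ _ d0 _) _.
        by rewrite -ltnS kl ltnW // (leq_trans lL).
      by rewrite le_eqVlt; apply/orP; left; apply/eqP; ring.
    have -> : D * g * avg K d * tau ^+ l = D * avg K d * tau ^+ l * g by ring.
    rewrite -mulr_sumr ler_wpM2l //; last exact: sum_geom_rev_le.
    by apply: mulr_ge0; [exact: mulr_ge0|exact: exprn_ge0].
  have -> : D * g * E * avg K d * w L = D * g * avg K d * (E * w L) by ring.
  by rewrite -mulr_sumr ler_wpM2l //; do 2 (apply: mulr_ge0 => //).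
rewrite avg_sum.
apply: (@le_trans _ _ (\sum_(L <= l < K) \sum_(0 <= k < L)
    D * avg K d * rho ^+ (l - k))).
  rewrite !big_nat ler_sum // => l /andP[Ll lK]; rewrite avg_sum.
  rewrite !big_nat ler_sum // => k /andP[_ kL].
  apply: le_trans (avg_shift_avg_le _ _ _ _ d0 _) _.
    by rewrite (ltnW lK) andbT ltnW // (leq_trans kL).
  rewrite [leLHS](_ : _ = D * avg K d * rho ^+ (l - k) * tau ^+ l); last by ring.
  by rewrite ler_piMr ?exprn_ile1 //; apply: mulr_ge0; [exact: mulr_ge0|exact: exprn_ge0].
under eq_bigr do rewrite -mulr_sumr.
rewrite -mulr_sumr [leRHS]mulrAC ler_wpM2l //; first exact: mulr_ge0.
exact: sum_geom_cross_le.
Qed.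

(** [shift_sum] is linear in [d]: the majorants of the increments of [G] add up, and so do the
    averages of the increments. The constant does not depend on [K], which allows [K] to tend to
    infinity later. *)
Lemma shift_sum_dominated K (G : nat -> vilenkin m -> R) :
  (forall t, 0 <= G 0%N t) ->
  (forall N t, G N t <= G N.+1 t) -> (forall N, cylindrical m N (G N)) ->
  exists H : vilenkin m -> R,
    (forall N x, (N <= K)%N -> shift_sum K N (G N) x <= H x) /\
    avg K H <= (2 * (D * g * E) + D * g ^+ 2) * avg K (G K).
Proof.
move=> G0 Gle Gcyl.
pose d L t := if L is L'.+1 then G L t - G L' t else G 0%N t.
have d0 L t : 0 <= d L t by case: L => [|L] //=; rewrite subr_ge0.
have dcyl L : cylindrical m L (d L).
  case: L => [|L] x y xy /=; first exact: Gcyl.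
  by rewrite (Gcyl _ x y xy) (Gcyl L x y) // => k kL; exact/xy/ltnW.
have Gd N t : G N t = \sum_(0 <= L < N.+1) d L t.
  elim: N => [|N IH]; first by rewrite big_nat1.
  by rewrite big_nat_recr //= -IH addrC subrK.
have /choice[H HP] : forall L, exists H : vilenkin m -> R, (L <= K)%N ->
    (forall N x, (L <= N <= K)%N -> shift_sum K N (d L) x <= H x) /\
    avg K H <= (2 * (D * g * E) + D * g ^+ 2) * avg K (d L).
  move=> L; have [LK|KL] := leqP L K; last by exists (fun=> 0).
  by have [H HP] := shift_sum_local _ _ _ LK (d0 L) (dcyl L); exists H.
exists (fun x => \sum_(0 <= L < K.+1) H L x); split.
  move=> N x NK.
  have -> : shift_sum K N (G N) x = \sum_(0 <= L < N.+1) shift_sum K N (d L) x.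
    rewrite /shift_sum -mulr_sumr; congr (_ * _).
    rewrite exchange_big; apply: eq_bigr => l _.
    rewrite exchange_big; apply: eq_bigr => k _.
    rewrite /shift_avg -mulr_sumr -avg_sum; congr (_ * _).
    by apply: eq_avg => t; rewrite Gd mulr_suml.
  apply: (@le_trans _ _ (\sum_(0 <= L < N.+1) H L x)).
    rewrite !big_nat ler_sum // => L /andP[_ LN].
    have LN' : (L <= N)%N by [].
    by have [HL _] := HP L (leq_trans LN' NK); apply: HL; rewrite LN' NK.
  (* The extra majorants, for [N < L <= K], are nonnegative because each dominates a nonnegative
     [shift_sum]. *)
  rewrite [leRHS](big_cat_nat (n := N.+1)) //= lerDl.
  rewrite big_nat sumr_ge0 // => L /andP[_ LK].
  have LK' : (L <= K)%N by [].
  have [HL _] := HP L LK'; apply: le_trans (HL K x _); last by rewrite LK' leqnn.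
  apply: mulr_ge0; first by rewrite invr_ge0 ltW.
  rewrite sumr_ge0 // => l _.
  by rewrite sumr_ge0 // => k _; exact: shift_avg_ge0.
rewrite avg_sum (eq_avg _ _ _ _ _ (Gd K)) avg_sum mulr_sumr.
rewrite !big_nat ler_sum // => L /andP[_ LK].
by have [] := HP L LK.
Qed.

End Domination.

(** * Characters, Haar integral and Fourier coefficients *)

Section Rademacher.
Variables (R : realType) (m : nat -> nat).
Hypothesis m_ge2 : forall k, (2 <= m k)%N.

Definition cis (a : R) : R[i] := (cos a +i* sin a)%C.

Lemma cisD a b : cis (a + b) = cis a * cis b.
Proof.
by apply/eqP; rewrite eq_complex /= cosD sinD eqxx /= addrC [cos a * _]mulrC.
Qed.

Lemma cis0 : cis 0 = 1.
Proof. by apply/eqP; rewrite eq_complex /= cos0 sin0 !eqxx. Qed.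

Lemma cisX a n : cis a ^+ n = cis (n%:R * a).
Proof.
elim: n => [|n IH]; first by rewrite expr0 mul0r cis0.
by rewrite exprS IH -cisD -natr1 mulrDl mul1r addrC.
Qed.

Lemma conj_cis a : (cis a)^* = cis (- a).
Proof. by apply/eqP; rewrite eq_complex /= cosN sinN !eqxx. Qed.

Lemma norm_cis a : `|cis a| = 1.
Proof. by rewrite normc_def /= cos2Dsin2 sqrtr1. Qed.

Lemma cis_2pi n : cis (n%:R * (2 * pi)) = 1.
Proof.
rewrite -cisX -[RHS](expr1n _ n); congr (_ ^+ n).
by apply/eqP; rewrite eq_complex /= mulr_natl cos2pi sin2pi !eqxx.
Qed.

(** If [cos b = 1] with [0 < b < 2 * pi], the double angle formula gives [sin (b / 2) = 0], which is
    impossible on the open interval from [0] to [pi]. Negative angles follow by conjugation. *)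
Lemma cis_neq1 a : a != 0 -> `|a| < 2 * pi -> cis a != 1.
Proof.
have key b : 0 < b -> b < 2 * pi -> cis b != 1.
  move=> b0 b2pi; apply/negP => /eqP[]/= cb _.
  have : 0 < sin (b / 2) by apply: sin_gt0_pi; lra.
  have : cos (b / 2 *+ 2) = 1 by rewrite -mulr_natl mulrCA divff ?mulr1.
  rewrite cos_mulr2n cos2sin2 => h s0.
  have : 0 < sin (b / 2) ^+ 2 by rewrite exprn_gt0.
  by move: h; rewrite mulr2n; lra.
move=> a0 a2; have [a_gt0|a_lt0|a00] := ltgtP a 0; last by rewrite a00 eqxx in a0.
  apply/eqP => ca; have : cis (- a) == 1 by rewrite -conj_cis ca conjC1.
  apply/negP/key; first by rewrite oppr_gt0.
  by rewrite ltr0_norm in a2.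
by apply: key => //; rewrite gtr0_norm in a2.
Qed.

Definition phase (x t : vilenkin m) k : R[i] :=
  rademacher k x * (rademacher k t)^*.

Lemma phaseE x t k : phase x t k =
  cis (((vcoord m x k)%:R - (vcoord m t k)%:R) * (2 * pi) / (m k)%:R).
Proof.
rewrite /phase -[rademacher k x]/(cis _) -[rademacher k t]/(cis _) conj_cis.
by rewrite -cisD /vcoord; congr cis; ring.
Qed.

Lemma norm_phase x t k : `|phase x t k| <= 1.
Proof. by rewrite phaseE norm_cis. Qed.

(** Orthogonality of characters: the phase is an [m k]-th root of unity, and it differs from [1]
    when the coordinates differ since their distance is less than [m k]. *)
Lemma sum_phase x t k : \sum_(u < m k) phase x t k ^+ u =
  if vcoord m x k == vcoord m t k then (m k)%:R else 0.
Proof.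
have mk0 : (m k)%:R != 0 :> R by rewrite pnatr_eq0 -lt0n m_gt0.
have [xt|xt] := eqVneq.
  rewrite phaseE xt subrr mul0r mul0r cis0.
  by rewrite (eq_bigr (fun=> 1)) ?sumr_const ?card_ord // => u _; rewrite expr1n.
have z1 : phase x t k != 1.
  rewrite phaseE; apply: cis_neq1.
    apply: mulf_neq0; last by rewrite invr_eq0.
    apply: mulf_neq0; first by rewrite subr_eq0 eqr_nat.
    by rewrite gt_eqF // mulr_gt0 ?pi_gt0.
  have mgt0 : 0 < (m k)%:R :> R by rewrite ltr0n m_gt0.
  rewrite normrM normfV normr_nat normrM [X in _ * X / _]ger0_norm; last first.
    by rewrite mulr_ge0 // pi_ge0.
  rewrite ltr_pdivrMr // mulrC ltr_pM2l ?mulr_gt0 ?pi_gt0 //.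
  have := coord_ltn m m_ge2 x k; have := coord_ltn m m_ge2 t k.
  rewrite -!(ltr_nat R) => ht hx.
  have := ler0n R (vcoord m x k); have := ler0n R (vcoord m t k).
  by rewrite ltr_norml => ? ?; apply/andP; split; lra.
apply: (mulfI (_ : phase x t k - 1 != 0)); first by rewrite subr_eq0.
rewrite -subrX1 mulr0 phaseE cisX mulrC divfK // mulrBl cisD -mulNr.
by rewrite mulNr -conj_cis !cis_2pi conjC1 mulr1 subrr.
Qed.

Lemma psi_conj_psi n (x t : vilenkin m) :
  psi n x * (psi n t)^* = char_prod m _ (phase x t) n :> R[i].
Proof.
rewrite /psi /char_prod rmorph_prod -big_split /=; apply: eq_bigr => k _.
by rewrite rmorphXn exprMn.
Qed.

Lemma psi_cylindrical n N : (n < Mprod m N)%N ->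
  cylindrical m N (psi n : vilenkin m -> R[i]).
Proof.
move=> nN x y xy.
rewrite -[psi n x]/(char_prod m _ (rademacher^~ x) n).
rewrite -[psi n y]/(char_prod m _ (rademacher^~ y) n).
rewrite !(char_prod_widen m _ m_ge2 _ _ _ nN); apply: eq_bigr => k _.
by rewrite /rademacher xy.
Qed.

End Rademacher.

(** * The Haar integral of functions of finite level *)

Section HaarIntegral.
Variables (R : realType) (m : nat -> nat).
Hypothesis m_ge2 : forall k, (2 <= m k)%N.
Local Notation M := (Mprod m).
Implicit Types (x y t : vilenkin m).

Lemma open_cyl N x : @open (vilenkin_space m) (cyl N x).
Proof.
elim: N => [|N IH].
  have -> : cyl 0 x = setT by apply/seteqP; split.
  exact: openT.
have -> : cyl N.+1 x = cyl N x `&`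
    (@proj nat (fun k => discrete_topology 'Z_(m k)) N) @^-1` [set x N].
  apply/seteqP; split => y /=.
    by move=> xy; split => [k kN|]; apply: xy => //; exact: ltnW.
  by move=> [xy yN] k; rewrite ltnS leq_eqVlt => /predU1P[->//|]; exact: xy.
apply: openI => //; apply: open_comp; last exact: discrete_open.
by move=> z _; exact: proj_continuous.
Qed.

Lemma measurable_cyl N x : measurable (cyl N x : set (vilenkin m)).
Proof. by apply: sub_sigma_algebra; exact: open_cyl. Qed.

Lemma in_cyl N x y : (y \in cyl N x) = agr m N N y x.
Proof. by apply/idP/agr_diagP => // [/set_mem|H]; [|apply/mem_set]. Qed.

Lemma vadd_cyl N a x : [set vadd a y | y in cyl N x] = cyl N (vadd a x).
Proof.
apply/seteqP; split => y /=.
  by move=> [z zx <-] k kN; rewrite /vadd zx.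
move=> yx; exists (vadd (fun k => - (a k : 'Z_(m k))) y).
  by move=> k kN; rewrite /vadd yx // /vadd addKr.
by apply: functional_extensionality_dep => k; rewrite /vadd addNKr.
Qed.

Variable mu : probability (vilenkin m) R.
Hypothesis mu_haar : haar mu.

Lemma cylindrical_indic N (g : vilenkin m -> R) : cylindrical m N g ->
  g = fun x => \sum_(s < M N) g (pt m s) * \1_(cyl N (pt m s)) x.
Proof.
move=> gN; apply: funext => x; rewrite -[LHS](cylindrical_sum_agr _ m_ge2 _ _ _ _ gN).
by apply: eq_bigr => s _; rewrite indicE in_cyl mulrC.
Qed.

(** The [M_N] cosets of level [N] partition the group and are translates of each other, so
    integrating the constant [1] coset by coset determines their common measure. *)
Lemma haar_cyl N x : mu (cyl N x) = ((M N)%:R^-1)%:E.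
Proof.
have muE y : mu (cyl N y) = mu (cyl N x).
  rewrite -(mu_haar (fun k => (y k : 'Z_(m k)) - x k) _ (measurable_cyl N x)) vadd_cyl.
  congr (mu (cyl N _)).
  by apply: functional_extensionality_dep => k; rewrite /vadd subrK.
have fin y : mu (cyl N y) \is a fin_num.
  by apply: fin_num_measure; exact: measurable_cyl.
have : (\int[mu]_y (1%R)%:E = (M N)%:R%:E * mu (cyl N x))%E.
  rewrite (eq_integral (fun y => \sum_(s < M N) (\1_(cyl N (pt m s)) y)%:E)%E); last first.
    move=> y _; rewrite sumEFin; congr EFin.
    rewrite [LHS](congr1 (@^~ y) (cylindrical_indic N (cst 1) _)) //.
    by apply: eq_bigr => s _; rewrite mul1r.
  rewrite ge0_integral_sum //; last first.
    by move=> s; apply/measurable_EFinP; apply: measurable_indic; exact: measurable_cyl.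
  rewrite (eq_bigr (fun=> mu (cyl N x))) => [|s _].
    rewrite -(fineK (fin x)) sumEFin sumr_const card_ord -EFinM.
    by rewrite mulr_natl.
  by rewrite integral_indic //; [rewrite setIT; exact: muE|exact: measurable_cyl].
have -> : (\int[mu]_y (1%R)%:E = 1)%E.
  by rewrite integral_cst // mul1e; exact: probability_setT.
rewrite -(fineK (fin x)) -EFinM => -[h].
congr EFin; apply: (mulfI (M_neq0 m m_ge2 R N)).
by rewrite -h divff // M_neq0.
Qed.

Lemma measurable_cylindrical N (g : vilenkin m -> R) : cylindrical m N g ->
  measurable_fun setT g.
Proof.
move=> gN; rewrite (cylindrical_indic _ _ gN); apply: measurable_sum => s.
apply: measurable_funM; first exact: measurable_cst.
by apply: measurable_indic; exact: measurable_cyl.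
Qed.

Lemma integrable_indic_cyl N x (c : R) :
  mu.-integrable setT (fun y => (c * \1_(cyl N x) y)%:E).
Proof.
under eq_fun do rewrite EFinM.
apply: integrableZl => //; apply: integrable_indic; exact: measurable_cyl.
Qed.

Lemma integral_cylindrical N (g : vilenkin m -> R) : cylindrical m N g ->
  (\int[mu]_x (g x)%:E = (avg N g)%:E)%E.
Proof.
move=> gN; rewrite (eq_integral (fun x =>
    \sum_(s < M N) (g (pt m s) * \1_(cyl N (pt m s)) x)%:E)%E); last first.
  by move=> x _; rewrite sumEFin {1}(cylindrical_indic _ _ gN).
rewrite integral_sum //; last by move=> s; exact: integrable_indic_cyl.
rewrite /avg mulr_sumr -sumEFin; apply: eq_bigr => s _.
under eq_integral do rewrite EFinM.
rewrite integralZl //; last by apply: integrable_indic; exact: measurable_cyl.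
rewrite integral_indic //; last exact: measurable_cyl.
transitivity ((g (pt m s))%:E * mu (cyl N (pt m s)))%E; first by rewrite setIT.
by rewrite haar_cyl -EFinM mulrC.
Qed.

End HaarIntegral.

(** * Martingales, Fourier coefficients and kernels as finite averages *)

Section ComplexFunctions.
Variables (R : realType) (m : nat -> nat).
Hypothesis m_ge2 : forall k, (2 <= m k)%N.
Local Notation M := (Mprod m).
Implicit Types (x y t : vilenkin m) (g h : vilenkin m -> R[i]).

Lemma cabsE (z : R[i]) : (cabs z)%:C%C = `|z|.
Proof. by rewrite /cabs normc_def. Qed.

Lemma cabs_ge0 (z : R[i]) : 0 <= cabs z.
Proof. by rewrite -lecR cabsE normr_ge0. Qed.

Lemma cabsM (z w : R[i]) : cabs (z * w) = cabs z * cabs w.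
Proof. by apply: complexI; rewrite rmorphM /= !cabsE normrM. Qed.

Lemma cabs_real (a : R) : cabs a%:C%C = `|a|.
Proof. by rewrite /cabs normc_def /= expr0n addr0 sqrtr_sqr. Qed.

Lemma cabsB_le (z w : R[i]) : cabs (z - w) <= cabs z + cabs w.
Proof. by rewrite -lecR rmorphD /= !cabsE ler_normB. Qed.

Lemma cabs_sum_le I (r : seq I) P (F : I -> R[i]) :
  cabs (\sum_(i <- r | P i) F i) <= \sum_(i <- r | P i) cabs (F i).
Proof.
by rewrite -lecR rmorph_sum /= cabsE [leRHS](eq_bigr (fun i => `|F i|)) ?ler_norm_sum //.
Qed.

Lemma real_complex_avg N (u : vilenkin m -> R) :
  (avg N u)%:C%C = avg N (fun x => (u x)%:C%C) :> R[i].
Proof. by rewrite /avg rmorphM rmorphV ?unitfE ?M_neq0 // rmorph_nat rmorph_sum. Qed.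

Lemma avg_complex N g :
  avg N g = (avg N (@complex.Re R \o g) +i* avg N (@complex.Im R \o g))%C.
Proof.
have -> : avg N g = avg N (fun x => (complex.Re (g x))%:C%C) +
    'i%C * avg N (fun x => (complex.Im (g x))%:C%C).
  by rewrite -avgZ -avgD; apply: eq_avg => x; rewrite -complexE.
by rewrite -!real_complex_avg [RHS]complexE.
Qed.

Lemma cylindrical_pair {T1 T2 T : Type} (op : T1 -> T2 -> T) N
    (g : vilenkin m -> T1) (h : vilenkin m -> T2) :
  cylindrical m N g -> cylindrical m N h -> cylindrical m N (fun x => op (g x) (h x)).
Proof. by move=> gN hN x y xy; rewrite (gN x y) // (hN x y). Qed.

Lemma cylindrical_comp {T1 T : Type} (op : T1 -> T) N (g : vilenkin m -> T1) :
  cylindrical m N g -> cylindrical m N (fun x => op (g x)).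
Proof. by move=> gN x y xy; rewrite (gN x y). Qed.

Lemma cylindrical_agr k l t : cylindrical m l (fun x => agr m k l x t).
Proof.
by move=> x y xy; apply/agrP/agrP => H i il ik; [rewrite -xy // H|rewrite xy // H].
Qed.

(** Sets saturated for agreement in the first [n] coordinates form a sigma-algebra containing the
    cylinders. *)
Lemma saturated_cylinders n A : <<s @cylinders m n >> A ->
  forall x y, (forall k, (k < n)%N -> x k = y k) -> A x -> A y.
Proof.
pose F := [set A : set (vilenkin m) | forall x y,
  (forall k, (k < n)%N -> x k = y k) -> A x -> A y].
suff : <<s @cylinders m n >> `<=` F by move=> H /H.
apply: smallest_sub; last first.
  by move=> _ [z _ <-] x y xy xz k kn; rewrite -xy // xz.
split.
- by move=> x y _ [].
- move=> D FD x y xy [_ nDx]; split => // Dy; apply: nDx.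
  by apply: FD Dy => k kn; rewrite xy.
- by move=> D FD x y xy [i _ Dx]; exists i => //; exact: FD xy Dx.
Qed.

Lemma measurable_cylinders_cylindrical n (u : vilenkin m -> R) :
  measurable_fun [set: g_sigma_algebraType (@cylinders m n)] u -> cylindrical m n u.
Proof.
move=> mu x y xy; have := mu measurableT [set u x] (measurable_set1 _).
by rewrite setTI => /saturated_cylinders /(_ x y xy) /(_ erefl) ->.
Qed.

Lemma adapted_cylindrical (f : nat -> vilenkin m -> R[i]) n :
  adapted f -> cylindrical m n (f n).
Proof.
move=> /(_ n)[/measurable_cylinders_cylindrical re /measurable_cylinders_cylindrical im].
move=> x y xy; have := re x y xy; have := im x y xy.
by move=> /=; case: (f n x) => a b; case: (f n y) => c d /= -> ->.
Qed.

Variable mu : probability (vilenkin m) R.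
Hypothesis mu_haar : haar mu.

Lemma cintegral_cylindrical N g : cylindrical m N g -> cintegral mu setT g = avg N g.
Proof.
move=> gN; rewrite avg_complex /cintegral /Rintegral.
by rewrite !(integral_cylindrical _ _ m_ge2 _ mu_haar N) //; exact: cylindrical_comp.
Qed.

Lemma cintegral_cyl n k x g : (n <= k)%N -> cylindrical m k g ->
  cintegral mu (cyl n x) g = avg k (fun y => (agr m n n y x)%:R * g y).
Proof.
move=> nk gk; rewrite -cintegral_cylindrical; last first.
  apply: cylindrical_pair => //.
  apply: (@cylindrical_comp _ _ (fun b : bool => b%:R)).
  exact: cylindrical_le nk (cylindrical_agr n n x).
rewrite /cintegral /Rintegral !(integral_mkcond (cyl n x)).
congr (fine _ +i* fine _)%C; apply: eq_integral => y _;
  rewrite /patch in_cyl; case: (agr _ _ _ _ _); rewrite ?mul1r ?mul0r //.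
Qed.

Variable f : nat -> vilenkin m -> R[i].
Hypothesis f_mart : martingale mu f.

Let f_cyl n : cylindrical m n (f n).
Proof. by apply: adapted_cylindrical; case: f_mart. Qed.

Lemma martingale_avg_cyl n k x : (n <= k)%N ->
  avg k (fun y => (agr m n n y x)%:R * f k y) = (M n)%:R^-1 * f n x.
Proof.
move=> nk; rewrite -cintegral_cyl //.
have [_ _ H] := f_mart; rewrite (H n k) //; last first.
  by apply: sub_sigma_algebra; exists x.
rewrite (cintegral_cyl n n) // /avg; congr (_ * _).
rewrite -[RHS](cylindrical_sum_agr _ m_ge2 _ n) //.
by apply: eq_bigr => s _; rewrite agr_sym.
Qed.

(** Expanding [g] over the cosets of level [n] reduces the claim to the martingale property on a
    single cylinder. *)
Lemma martingale_avg n k g : (n <= k)%N -> cylindrical m n g ->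
  avg k (fun y => f k y * g y) = avg n (fun y => f n y * g y).
Proof.
move=> nk gn.
transitivity (avg k (fun y => \sum_(s < M n)
    g (pt m s) * ((agr m n n y (pt m s))%:R * f k y))).
  apply: eq_avg => y; rewrite -[g y](cylindrical_sum_agr _ m_ge2 _ n) //.
  by rewrite mulr_sumr; apply: eq_bigr => s _; ring.
rewrite avg_sum [RHS]/avg mulr_sumr; apply: eq_bigr => s _.
by rewrite avgZ martingale_avg_cyl //; ring.
Qed.

(** [psi j] has level [N], so the sequence defining the coefficient is constant from index [N]
    on. *)
Lemma fourier_coef_avg N j : (j < M N)%N ->
  fourier_coef mu f j = avg N (fun t => f N t * (psi j t)^*).
Proof.
move=> jN; have pN : cylindrical m N (fun t => (psi j t)^* : R[i]).
  by apply: cylindrical_comp; exact: psi_cylindrical.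
rewrite /fourier_coef; apply: (@cvg_lim R[i]^o); first exact: norm_hausdorff.
apply: cvg_near_cst; exists N => // k /= Nk.
rewrite (@cintegral_cylindrical k); first exact: martingale_avg.
by apply: cylindrical_pair => //; apply: cylindrical_le pN.
Qed.

Definition sum_partial_sums n x : R[i] := \sum_(k < n) partial_sum mu f k x.

(** All coefficients involved have index below [M_N], so they are averages at the same level [N] and
    combine into one kernel. *)
Lemma sum_partial_sums_avg N n x : (n < M N)%N ->
  sum_partial_sums n x = avg N (fun t => f N t * dirichlet_sum m _ (phase R m x t) n).
Proof.
move=> nN; rewrite /sum_partial_sums.
under [RHS]eq_avg do rewrite /dirichlet_sum mulr_sumr.
rewrite avg_sum; apply: eq_bigr => k _; rewrite /partial_sum.
under [RHS]eq_avg do rewrite /dirichlet mulr_sumr.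
rewrite avg_sum; apply: eq_bigr => j _.
rewrite (@fourier_coef_avg N); last first.
  exact: ltn_trans (ltn_trans (ltn_ord j) (ltn_ord k)) nN.
rewrite mulrC -avgZ; apply: eq_avg => t.
by rewrite -psi_conj_psi; ring.
Qed.

Variable B : nat.
Hypothesis m_le : forall k, (m k <= B)%N.

Lemma sum_partial_sums_le N n x : (n < M N)%N ->
  cabs (sum_partial_sums n x) <= 2 * B%:R ^+ 3 *
  avg N (fun t => cabs (f N t) *
    \sum_(l < N) \sum_(k < l.+1) (M k * M l)%:R * (agr m k l x t)%:R).
Proof.
move=> nN; rewrite -avgZ -lecR real_complex_avg cabsE (sum_partial_sums_avg _ _ _ nN).
apply: le_trans (ler_norm_avg _ _ _ _) _; apply: ler_avg => t.
rewrite normrM mulrCA rmorphM /= cabsE ler_wpM2l //.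
have := dirichlet_sum_le m B _ m_ge2 m_le (phase R m x t) _
  (norm_phase R m x t) (sum_phase R m m_ge2 x t) _ _ nN.
move=> /le_trans; apply; rewrite !rmorphM exprS expr2 !rmorph_nat rmorph_sum /=.
rewrite ler_wpM2l ?mulr_ge0 // ler_sum // => l _.
rewrite rmorph_sum ler_sum // => k _.
by rewrite [leRHS]rmorphM !rmorph_nat.
Qed.

End ComplexFunctions.

(** * Fejer means of H_p martingales *)

Section Powers.
Variables (R : realType) (p : R).
Hypotheses (p_gt0 : 0 < p) (p_le1 : p <= 1).

(** With [s = a + b], the ratios [a / s] and [b / s] lie between [0] and [1] and add up to [1];
    raising them to the power [p <= 1] can only increase them. *)
Lemma powRD_le (a b : R) : 0 <= a -> 0 <= b -> (a + b) `^ p <= a `^ p + b `^ p.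
Proof.
move=> a0 b0; have [s0|s0] := eqVneq (a + b) 0.
  by rewrite s0 powR0 ?gt_eqF // addr_ge0 ?powR_ge0.
have s_gt0 : 0 < a + b by rewrite lt_neqAle eq_sym s0 addr_ge0.
have key c : 0 <= c -> c <= a + b -> c / (a + b) * (a + b) `^ p <= c `^ p.
  move=> c0 cs; have [->|cn0] := eqVneq c 0; first by rewrite !mul0r powR_ge0.
  have c_gt0 : 0 < c by rewrite lt_neqAle eq_sym cn0.
  rewrite -[in leRHS](divfK s0 c) powRM ?divr_ge0 ?(ltW s_gt0) //.
  rewrite ler_wpM2r ?powR_ge0 // ger1_powR // divr_gt0 //= ler_pdivrMr // mul1r //.
apply: le_trans (lerD (key a a0 _) (key b b0 _)); rewrite ?lerDl ?lerDr //.
by rewrite -mulrDl -mulrDl divff // mul1r.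
Qed.

Lemma powR_sum_le (I : Type) (r : seq I) (P : pred I) (F : I -> R) :
  (forall i, 0 <= F i) ->
  (\sum_(i <- r | P i) F i) `^ p <= \sum_(i <- r | P i) F i `^ p.
Proof.
move=> F0; elim: r => [|i r IH]; first by rewrite !big_nil powR0 ?gt_eqF.
rewrite !big_cons; case: ifP => // _.
apply: le_trans (powRD_le _ _ _ _) _ => //; first exact: sumr_ge0.
by rewrite lerD2l.
Qed.

Lemma powR_exprn (a : R) n : 0 <= a -> (a ^+ n) `^ p = (a `^ p) ^+ n.
Proof. by move=> a0; rewrite -!powR_mulrn ?powR_ge0 // powRAC. Qed.

Lemma powR_bool (b : bool) : (b%:R : R) `^ p = b%:R.
Proof. by case: b; rewrite ?powR1 // powR0 // gt_eqF. Qed.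

End Powers.

(** * Growth of the weights along the scale [M_N] *)

Section Weights.
Variables (R : realType) (m : nat -> nat) (B : nat).
Hypotheses (m_ge2 : forall k, (2 <= m k)%N) (m_le : forall k, (m k <= B)%N).
Local Notation M := (Mprod m).
Variable p : R.
Hypotheses (p_gt0 : 0 < p) (p_le : p <= 2^-1).

(** Comparable to the [p]-th power of the logarithmic factor of [Tweight p n] for
[M_(N-1) <= n < M_N]. *)
Definition level_weight N : R := if p == 2^-1 then N.+1%:R else 1.

Let p_le1 : p <= 1. Proof. by rewrite (le_trans p_le) // invf_le1 // ler1n. Qed.
Local Notation rho := ((2 : R) `^ (- p)).
Local Notation tau := ((2 : R) `^ (2 * p - 1)).

Lemma rho_lt1 : rho < 1.
Proof.
rewrite powRN invf_lt1 ?powR_gt0 // -[ltLHS](powRr0 2).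
by rewrite /powR pnatr_eq0 /= ltr_expR ltr_pM2r // ln_gt0 // ltr1n.
Qed.

Lemma tau_le1 : tau <= 1.
Proof. by rewrite -[leRHS](powRr0 2) ler_powR ?ler1n //; move: (p_le); lra. Qed.

Lemma tau_lt1 : p != 2^-1 -> tau < 1.
Proof.
move=> pn; have {}pn : p < 2^-1 by rewrite lt_neqAle pn.
rewrite -[ltRHS](powRr0 2) /powR pnatr_eq0 /= ltr_expR ltr_pM2r; first by lra.
by rewrite ln_gt0 // ltr1n.
Qed.

Lemma level_weight_ge1 N : 1 <= level_weight N.
Proof. by rewrite /level_weight; case: ifP => // _; rewrite ler1n. Qed.

Lemma level_weight_le : {homo level_weight : N K / (N <= K)%N >-> N <= K}.
Proof. by move=> N K NK; rewrite /level_weight; case: ifP => // _; rewrite ler_nat. Qed.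

(** At [p = 1/2] the ratio [tau] is [1] and the sum grows linearly; below, it is a convergent
    geometric sum. This dictates [level_weight]. *)
Lemma sum_tau_le : exists E, forall N, \sum_(0 <= l < N) tau ^+ l <= E * level_weight N.
Proof.
rewrite /level_weight; case: eqVneq => [pE|/tau_lt1 t1].
  exists 1 => N; rewrite mul1r pE divff // subrr powRr0.
  under eq_bigr do rewrite expr1n.
  rewrite sumr_const_nat subn0; exact: (etrans (ler_nat R N N.+1) (leqnSn N)).
by exists (1 - tau)^-1 => N; rewrite mulr1 sum_geom_le // powR_ge0.
Qed.

(** The factor [rho] comes from [2 ^ (l - k) * M_k <= M_l], and [tau] from [2 ^ l <= M_l] raised to
    the nonpositive power [2 * p - 1]. *)
Lemma powR_Mprod_le k l : (k <= l)%N ->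
  (M k * M l)%:R `^ p * (B%:R / (M l)%:R) <= B%:R * rho ^+ (l - k) * tau ^+ l.
Proof.
move=> kl.
have Ml0 : 0 < (M l)%:R :> R by exact: M_gt0.
have h1 : (M k)%:R `^ p <= rho ^+ (l - k) * (M l)%:R `^ p.
  rewrite powRN exprVn ler_pdivlMl ?exprn_gt0 ?powR_gt0 //.
  rewrite -powR_exprn // -powRM ?exprn_ge0 // -natrX -natrM.
  by rewrite ge0_ler_powR ?nnegrE ?(ltW p_gt0) // ler_nat leq_Mprod.
have h2 : (M l)%:R `^ p * (M l)%:R `^ p / (M l)%:R <= tau ^+ l.
  rewrite -powRD; last by rewrite (gt_eqF Ml0) implybT.
  rewrite -[X in _ / X]powRr1 ?(ltW Ml0) // -powRB; last first.
    by rewrite (gt_eqF Ml0) implybT.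
  rewrite (_ : p + p - 1 = - (1 - 2 * p)); last by ring.
  rewrite (_ : 2 * p - 1 = - (1 - 2 * p)); last by ring.
  rewrite !powRN exprVn lef_pV2 ?posrE ?exprn_gt0 ?powR_gt0 //.
  rewrite -powR_mulrn ?powR_ge0 // powRAC ge0_ler_powR ?nnegrE ?powR_ge0 //.
    by move: (p_le); lra.
  by rewrite powR_mulrn // -natrX ler_nat expn2_Mprod.
rewrite natrM powRM // [leLHS](_ : _ =
    B%:R * (M k)%:R `^ p * ((M l)%:R `^ p / (M l)%:R)); last by ring.
apply: (@le_trans _ _ (B%:R * (rho ^+ (l - k) * (M l)%:R `^ p) *
    ((M l)%:R `^ p / (M l)%:R))).
  by rewrite ler_wpM2r ?divr_ge0 ?powR_ge0 // ler_wpM2l.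
rewrite [leLHS](_ : _ = B%:R * rho ^+ (l - k) *
   ((M l)%:R `^ p * (M l)%:R `^ p / (M l)%:R)); last by ring.
by rewrite ler_wpM2l // mulr_ge0 // exprn_ge0 // powR_ge0.
Qed.

(** For [p = 1/2] the power of [n + 1] is trivial and the floor is [1]; for smaller [p] the floor is
    [0] and the logarithm disappears. *)
Lemma TweightE n : Tweight p n =
  if p == 2^-1 then ln n.+1%:R ^+ 2 else n.+1%:R `^ (p^-1 - 2).
Proof.
rewrite /Tweight; case: eqVneq => [->|pn].
  rewrite invrK subrr powRr0 mul1r (_ : Num.floor _ = 1) ?mulr1 //.
  by apply: floor_def; apply/andP; split; rewrite ?intrD; lra.
have {}pn : p < 2^-1 by rewrite lt_neqAle pn.
rewrite (_ : Num.floor (2^-1 + p) = 0) ?mulr0 ?expr0z ?mulr1 //.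
by apply: floor_def; apply/andP; split; rewrite ?add0r /=; move: (p_gt0); lra.
Qed.

Lemma ln_Sn_gt0 n : (0 < n)%N -> 0 < ln n.+1%:R :> R.
Proof. by move=> n0; rewrite ln_gt0 // ltr1n. Qed.

Lemma Tweight_gt0 n : (0 < n)%N -> 0 < Tweight p n.
Proof.
by move=> n0; rewrite TweightE; case: ifP => _; rewrite ?powR_gt0 // exprn_gt0 // ln_Sn_gt0.
Qed.

Lemma p_inv_ge2 : 0 <= p^-1 - 2.
Proof. by rewrite subr_ge0 -[leLHS]invrK lef_pV2 ?posrE // invr_gt0. Qed.

Lemma Tweight_le : {homo Tweight p : n k / (n <= k)%N >-> n <= k}.
Proof.
move=> n k nk; rewrite !TweightE; case: ifP => _.
  have h0 j : 0 <= ln j.+1%:R :> R by rewrite ln_ge0 // ler1n.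
  by rewrite lerXn2r ?nnegrE // ler_ln ?posrE ?ltr0n // ler_nat.
by rewrite ge0_ler_powR ?nnegrE ?p_inv_ge2 // ler_nat ltnS.
Qed.

Lemma level_weight_Tweight : exists2 C : R, 0 <= C & forall N n, (M N <= n)%N ->
  (M N.+1)%:R `^ (1 - p) * level_weight N.+1 <= C * (n%:R * Tweight p n) `^ p.
Proof.
have ln2 : 0 < ln 2 :> R by rewrite ln_gt0 // ltr1n.
have B1 : 1 <= B%:R :> R by rewrite ler1n (leq_trans _ (m_le 0)) // ltnW.
have MB N n : (M N <= n)%N -> (M N.+1)%:R `^ (1 - p) <= B%:R * n%:R `^ (1 - p).
  move=> Nn; apply: (@le_trans _ _ ((B%:R * n%:R) `^ (1 - p))).
    rewrite ge0_ler_powR ?nnegrE ?subr_ge0 // -natrM ler_nat MprodS mulnC.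
    exact: leq_mul.
  rewrite powRM // ler_wpM2r ?powR_ge0 // -[leRHS]powRr1 // ler_powR //.
  by rewrite gerBl ltW.
(* [B] comes from [M_(N+1) <= B * n]. At [p = 1/2], adding [N * ln 2 <= ln (n + 1)] and twice
   [ln 2 <= ln (n + 1)] bounds [N + 2] by [3 / ln 2] times the logarithm; for smaller [p],
   [3 / ln 2 >= 1] suffices. *)
exists (B%:R * (3 / ln 2)); first by rewrite !mulr_ge0 // invr_ge0 ltW.
move=> N n Nn; have n0 : (0 < n)%N by apply: leq_trans Nn; exact: Mprod_gt0.
have MBn := MB N n Nn; have lnn := ln_Sn_gt0 n n0.
rewrite /level_weight TweightE; case: eqVneq => [pE|pn].
  rewrite powRM ?sqr_ge0 //.
  have -> : (ln n.+1%:R ^+ 2) `^ p = ln n.+1%:R :> R.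
    by rewrite -powR_mulrn ?ltW // -powRrM pE divff // powRr1 // ltW.
  have -> : B%:R * (3 / ln 2) * (n%:R `^ p * ln n.+1%:R) =
    (B%:R * n%:R `^ p) * (3 / ln 2 * ln n.+1%:R) by ring.
  rewrite (_ : 1 - p = p) in MBn *; last by rewrite pE; lra.
  rewrite ler_pM ?powR_ge0 //.
  rewrite mulrAC ler_pdivlMr //.
  have h1 : ln 2 <= ln n.+1%:R :> R by rewrite ler_ln ?posrE // ler_nat.
  have h2 : N%:R * ln 2 <= ln n.+1%:R :> R.
    rewrite mulr_natl -lnXn // ler_ln ?posrE ?exprn_gt0 // -natrX ler_nat.
    by rewrite (leq_trans (expn2_Mprod m m_ge2 N)) // (leq_trans Nn).
  rewrite (_ : N.+2%:R = N%:R + 2 :> R); last by rewrite -natrD addn2.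
  by rewrite mulrDl; move: h1 h2; set a := N%:R * _; lra.
rewrite mulr1 (le_trans MBn) // -mulrA ler_wpM2l //.
have h3 : 1 <= 3 / ln 2 :> R.
  by rewrite ler_pdivlMr // mul1r (le_trans (ltW (ln_sublinear _))) // ler_nat.
have h4 : n%:R `^ (1 - p) <= (n%:R * n.+1%:R `^ (p^-1 - 2)) `^ p.
  rewrite (_ : 1 - p = (p^-1 - 1) * p); last by rewrite mulrBl mulVf ?gt_eqF // mul1r.
  rewrite powRrM ge0_ler_powR ?nnegrE ?mulr_ge0 ?powR_ge0 ?(ltW p_gt0) //.
  rewrite (_ : p^-1 - 1 = 1 + (p^-1 - 2)); last by ring.
  rewrite powRD; last by rewrite pnatr_eq0 -lt0n n0 implybT.
  rewrite powRr1 // ler_wpM2l // ge0_ler_powR ?nnegrE ?p_inv_ge2 //.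
  by rewrite ler_nat.
by rewrite (le_trans h4) // ler_peMl // powR_ge0.
Qed.

End Weights.

(** * Domination of the weighted sums of partial sums *)

Section Fejer.
Variables (R : realType) (m : nat -> nat) (B : nat).
Hypotheses (m_ge2 : forall k, (2 <= m k)%N) (m_le : forall k, (m k <= B)%N).
Local Notation M := (Mprod m).
Variables (mu : probability (vilenkin m) R) (p : R).
Hypotheses (mu_haar : haar mu) (p_gt0 : 0 < p) (p_le : p <= 2^-1).
Implicit Types (f : nat -> vilenkin m -> R[i]) (x t : vilenkin m).

Let p_le1 : p <= 1.
Proof. by rewrite (le_trans p_le) // invf_le1 // ler1n. Qed.

(** The process [G_N]; the default [0] is harmless because the powers are nonnegative. *)
Definition running_max f N x : R :=
  \big[Num.max/0]_(n < N.+1) (cabs (f n x) `^ p).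

Lemma running_max_ge0 f N x : 0 <= running_max f N x.
Proof. exact: bigmax_ge_id. Qed.

Lemma running_max_ge f N n x : (n <= N)%N -> cabs (f n x) `^ p <= running_max f N x.
Proof.
move=> nN; have nN1 : (n < N.+1)%N by [].
exact: (le_bigmax _ (fun i : 'I_N.+1 => cabs (f i x) `^ p) (Ordinal nN1)).
Qed.

Lemma running_max_leS f N x : running_max f N x <= running_max f N.+1 x.
Proof.
apply/bigmax_leP; split; first exact: running_max_ge0.
by move=> i _; apply: running_max_ge; rewrite ltnW // ltn_ord.
Qed.

Lemma running_max_cylindrical f N : martingale mu f -> cylindrical m N (running_max f N).
Proof.
move=> [fa _ _] x y xy; apply: eq_bigr => n _.
rewrite (adapted_cylindrical _ _ f n fa x y) // => k kn; apply: xy.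
by rewrite (leq_trans kn) // -ltnS.
Qed.

Lemma sum_partial_sums_powR_le f N n x : martingale mu f -> (n < M N)%N ->
  cabs (sum_partial_sums R m mu f n x) `^ p <=
  (2 * B%:R ^+ 3) `^ p * (M N)%:R `^ (1 - p) *
  \sum_(0 <= l < N) \sum_(0 <= k < l.+1) (M k * M l)%:R `^ p *
    avg N (fun t => cabs (f N t) `^ p * (agr m k l x t)%:R).
Proof.
move=> f_mart nN; have MN0 := M_gt0 m m_ge2 R N.
have D0 : 0 <= 2 * B%:R ^+ 3 :> R by rewrite mulr_ge0 // exprn_ge0.
have c0 z : 0 <= cabs z := cabs_ge0 R z.
have hn := sum_partial_sums_le R m m_ge2 mu mu_haar f f_mart B m_le N n x nN.
set u := fun t => _ in hn.
have u0 t : 0 <= u t.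
  rewrite mulr_ge0 // sumr_ge0 // => l _.
  by rewrite sumr_ge0 // => k _; rewrite mulr_ge0.
have au0 : 0 <= avg N u by exact: avg_ge0.
apply: (@le_trans _ _ ((2 * B%:R ^+ 3 * avg N u) `^ p)).
  by rewrite ge0_ler_powR ?nnegrE ?(ltW p_gt0) // mulr_ge0.
rewrite (powRM p D0 au0).
rewrite -mulrA ler_wpM2l ?powR_ge0 //.
rewrite {1}/avg powRM ?invr_ge0 ?(ltW MN0) //; last first.
  exact: sumr_ge0.
have -> : \sum_(0 <= l < N) \sum_(0 <= k < l.+1) (M k * M l)%:R `^ p *
    avg N (fun t => cabs (f N t) `^ p * (agr m k l x t)%:R) =
  (M N)%:R^-1 * \sum_(s < M N) \sum_(l < N) \sum_(k < l.+1)
    cabs (f N (pt m s)) `^ p * ((M k * M l)%:R `^ p * (agr m k l x (pt m s))%:R).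
  rewrite exchange_big mulr_sumr big_mkord; apply: eq_bigr => l _.
  rewrite exchange_big mulr_sumr big_mkord; apply: eq_bigr => k _.
  rewrite /avg mulrCA; congr (_ * _); rewrite mulr_sumr.
  by apply: eq_bigr => s _; rewrite mulrCA.
(* The factor [M_N^-1] of the average, raised to the power [p], is split as [M_N ^ (1 - p)] times
   [M_N^-1]: the sum of powers is again an average, at the price of [M_N ^ (1 - p)]. *)
rewrite mulrA -powR_inv1 ?(ltW MN0) // -powRrM -powRD; last first.
  by rewrite (gt_eqF MN0) implybT.
rewrite (_ : -1 * p = 1 - p + -1); last by ring.
rewrite ler_wpM2l ?powR_ge0 //.
apply: le_trans (powR_sum_le _ _ p_gt0 p_le1 _ _ _ _ _) _.
  by move=> s; exact: u0.
apply: ler_sum => s _; rewrite /u powRM //; last first.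
  by rewrite sumr_ge0 // => l _; rewrite sumr_ge0 // => k _; rewrite mulr_ge0.
under [leRHS]eq_bigr do rewrite -mulr_sumr.
rewrite -mulr_sumr ler_wpM2l ?powR_ge0 //.
apply: le_trans (powR_sum_le _ _ p_gt0 p_le1 _ _ _ _ _) _.
  by move=> l; rewrite sumr_ge0 // => k _; rewrite mulr_ge0.
apply: ler_sum => l _.
apply: le_trans (powR_sum_le _ _ p_gt0 p_le1 _ _ _ _ _) _.
  by move=> k; rewrite mulr_ge0.
by apply: ler_sum => k _; rewrite powRM // powR_bool.
Qed.

Lemma fejer_dominated : exists2 C : R, 0 <= C & forall f K, martingale mu f ->
  exists H : vilenkin m -> R,
    [/\ forall x, 0 <= H x,
        forall n x, (0 < n < M K)%N ->
          (cabs (sum_partial_sums R m mu f n x) / (n%:R * Tweight p n)) `^ p <= H x &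
        avg K H <= C * avg K (running_max f K)].
Proof.
have [E sumE] := sum_tau_le R p p_le.
have [C C0 weightC] := level_weight_Tweight R m B m_ge2 m_le p p_gt0 p_le.
set rho : R := 2 `^ (- p) in sumE *; set tau : R := 2 `^ (2 * p - 1) in sumE *.
have rho1 : rho < 1 by exact: rho_lt1.
have E0 : 0 <= E.
  by have := sumE 0; rewrite big_nil pmulr_lge0 // (lt_le_trans _ (level_weight_ge1 _ _ _)).
pose A := 2 * (B%:R * (1 - rho)^-1 * E) + B%:R * (1 - rho)^-1 ^+ 2.
pose D : R := (2 * B%:R ^+ 3) `^ p * C.
have A0 : 0 <= A.
  have g0 : 0 <= (1 - rho)^-1 by rewrite invr_ge0 subr_ge0 ltW.
  by rewrite addr_ge0 // !mulr_ge0 // ?exprn_ge0.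
have D0 : 0 <= D by rewrite mulr_ge0 // powR_ge0.
exists (D * A); first exact: mulr_ge0.
move=> f K f_mart.
have [H [Hdom Havg]] := shift_sum_dominated R m B m_ge2 m_le rho tau B%:R E
  (fun k l => (M k * M l)%:R `^ p) (level_weight R p)
  (powR_ge0 _ _) rho1 (powR_ge0 _ _) (tau_le1 R p p_le) (ler0n R B)
  (fun k l => powR_ge0 _ _) (powR_Mprod_le R m B m_ge2 p p_gt0 p_le)
  (level_weight_ge1 R p) (level_weight_le R p) sumE K (running_max f)
  (running_max_ge0 f 0) (running_max_leS f)
  (fun N => running_max_cylindrical f N f_mart).
exists (fun x => D * H x); split.
- move=> x; rewrite mulr_ge0 // (le_trans _ (Hdom 0%N x isT)) //.
  by rewrite /shift_sum big_geq // mulr0.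
2:by rewrite avgZ -mulrA ler_wpM2l.
move=> n x /andP[n0 nK].
(* The level is the least one with [n < M_(N+1)], so that also [M_N <= n], as the weight comparison
   requires. *)
have exN : exists N, (n < M N)%N by exists n; exact: ltn_Mprod.
case: (ex_minnP exN) => -[|N]; first by rewrite Mprod0 ltnS leqNgt n0.
move=> nN minN; have NK : (N.+1 <= K)%N by exact: minN.
have Nn : (M N <= n)%N by rewrite leqNgt; apply/negP => /minN; rewrite ltnn.
have nT0 : 0 < n%:R * Tweight p n.
  by rewrite mulr_gt0 ?ltr0n // Tweight_gt0.
have cyl_f : cylindrical m N.+1 (f N.+1).
  by apply: adapted_cylindrical; case: f_mart.
rewrite powRM ?cabs_ge0 ?invr_ge0 ?(ltW nT0) // -powR_inv1 ?(ltW nT0) //.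
rewrite -powRrM mulN1r powRN ler_pdivrMr ?powR_gt0 //.
apply: le_trans (sum_partial_sums_powR_le _ _ _ _ f_mart nN) _.
rewrite /D -!mulrA ler_wpM2l ?powR_ge0 //.
have w0 : 0 < level_weight R p N.+1.
  by rewrite (lt_le_trans _ (level_weight_ge1 _ _ _)).
apply: (@le_trans _ _ ((M N.+1)%:R `^ (1 - p) * (level_weight R p N.+1 *
    shift_sum R m (fun k l => (M k * M l)%:R `^ p) (level_weight R p) K N.+1
      (running_max f N.+1) x))).
  rewrite ler_wpM2l ?powR_ge0 // /shift_sum mulVKf ?gt_eqF //.
  rewrite !big_nat ler_sum // => l /andP[_ lN].
  rewrite !big_nat ler_sum // => k _; rewrite ler_wpM2l ?powR_ge0 //.
  (* The integrand has level [N + 1 <= K], so its average may be taken at the common level [K]. *)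
  rewrite -(avg_cylindrical _ m_ge2 _ _ _ _ NK); last first.
    move=> y z yz; rewrite (cyl_f y z yz); congr (_ * _%:R).
    congr nat_of_bool; rewrite agr_sym [RHS]agr_sym.
    by apply: (cylindrical_agr m k l x y z) => i il; apply: yz; exact: ltn_trans il lN.
  by apply: ler_avg => t; rewrite ler_wpM2r // running_max_ge.
have S0 : 0 <= shift_sum R m (fun k l => (M k * M l)%:R `^ p) (level_weight R p) K N.+1
      (running_max f N.+1) x.
  rewrite mulr_ge0 ?invr_ge0 ?(ltW w0) // sumr_ge0 // => l _.
  rewrite sumr_ge0 // => k _; apply: mulr_ge0; rewrite ?powR_ge0 //.
  by apply: avg_ge0 => t; rewrite mulr_ge0 // running_max_ge0.
apply: (@le_trans _ _ (C * (n%:R * Tweight p n) `^ p *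
  shift_sum R m (fun k l => (M k * M l)%:R `^ p) (level_weight R p) K N.+1
      (running_max f N.+1) x)).
  by rewrite mulrA ler_wpM2r // weightC.
rewrite -mulrA ler_wpM2l // mulrC ler_wpM2r ?powR_ge0 //; exact: Hdom.
Qed.

End Fejer.

(** * T means *)

Lemma le_powR_inv (R : realType) (p a b : R) : 0 < p -> 0 <= a ->
  a `^ p <= b -> a <= b `^ p^-1.
Proof.
move=> p0 a0 ab; have -> : a = (a `^ p) `^ p^-1.
  by rewrite -powRrM divff ?gt_eqF // powRr1.
rewrite ge0_ler_powR ?invr_ge0 ?(ltW p0) ?nnegrE ?powR_ge0 //.
exact: le_trans (powR_ge0 _ _) ab.
Qed.

(** [v K] stands for a finite maximum of the powers [u n ^ p]: it lies below every nonnegative bound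
    of them, and each of them lies below some [v K]. Monotonicity of the power then lets it pass
    through the supremum. *)
Lemma poweR_ereal_sup (R : realType) (p : R) (S : set nat) (u v : nat -> R) :
  0 < p -> S !=set0 -> (forall n, S n -> 0 <= u n) -> (forall K, 0 <= v K) ->
  (forall K r, 0 <= r -> (forall n, S n -> u n `^ p <= r) -> v K <= r) ->
  (forall n, S n -> exists K, u n `^ p <= v K) ->
  (`|ereal_sup [set (u n)%:E | n in S]| `^ p)%E =
  ereal_sup (range (fun K => (v K)%:E)).
Proof.
move=> p0 [n0 Sn0] u0 v0 v_le u_le; set U := ereal_sup [set _ | _ in S].
have uU n : S n -> ((u n)%:E <= U)%E by move=> Sn; apply: ereal_sup_ubound; exists n.
have U0 : (0 <= U)%E by apply: le_trans (uU _ Sn0); rewrite lee_fin u0.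
have U_le y : (forall n, S n -> ((u n)%:E <= y)%E) -> (U <= y)%E.
  by move=> uy; apply: ge_ereal_sup => _ [n Sn <-]; exact: uy.
clearbody U; set V := (X in _ = X).
have vV K : ((v K)%:E <= V)%E by apply: ereal_sup_ubound; exists K.
have V0 : (0 <= V)%E by apply: le_trans (vV 0%N); rewrite lee_fin.
have V_le y : (forall K, ((v K)%:E <= y)%E) -> (V <= y)%E.
  by move=> vy; apply: ge_ereal_sup => _ [K _ <-]; exact: vy.
clearbody V; rewrite gee0_abs //; apply/le_anti/andP; split.
  case: V V0 vV {V_le} => [r| |] V0 vV //; last by rewrite leey.
  rewrite lee_fin in V0.
  have : (U <= (r `^ p^-1)%:E)%E.
    apply: U_le => n Sn; rewrite lee_fin.
    have [K uv] := u_le n Sn; have := vV K; rewrite lee_fin => /(le_trans uv) ur.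
    exact: le_powR_inv (u0 n Sn) ur.
  case: U U0 {uU U_le} => [s| |] //=; rewrite !lee_fin => s0 sr.
  rewrite -[leRHS]powRr1 // -(mulVf (lt0r_neq0 p0)) powRrM.
  by rewrite ge0_ler_powR ?nnegrE ?powR_ge0 ?(ltW p0).
(* If [U] is infinite, so is its power since [p] is positive; otherwise [U ^ p] bounds all
   [u n ^ p]. *)
apply: V_le => K; case: U U0 uU {U_le} => [s| |] //=; last first.
  by move=> _ _; rewrite (gt_eqF p0) leey.
rewrite !lee_fin => s0 us; apply: v_le; first exact: powR_ge0.
move=> n Sn; have := us n Sn; rewrite lee_fin => uns.
by rewrite ge0_ler_powR ?nnegrE ?(ltW p0) ?u0.
Qed.

(** Monotone convergence, the supremum of a nondecreasing sequence being its limit. *)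
Lemma integral_ereal_sup d (T : measurableType d) (R : realType)
    (mu : {measure set T -> \bar R}) (v : nat -> T -> R) :
  (forall K, measurable_fun setT (v K)) -> (forall K x, 0 <= v K x) ->
  (forall K x, v K x <= v K.+1 x) ->
  (\int[mu]_x ereal_sup (range (fun K => (v K x)%:E)) =
   ereal_sup (range (fun K => \int[mu]_x (v K x)%:E)))%E.
Proof.
move=> mv v0 v_le.
have v_nd x : {homo (fun K => (v K x)%:E) : n k / (n <= k)%N >-> (n <= k)%E}.
  by apply/nondecreasing_seqP => K; rewrite lee_fin.
have i_nd : {homo (fun K => (\int[mu]_x (v K x)%:E)%E) : n k / (n <= k)%N >-> (n <= k)%E}.
  move=> n k nk; apply: ge0_le_integral => //.
  - by move=> x _; rewrite lee_fin.
  - exact/measurable_EFinP.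
  - exact/measurable_EFinP.
  - by move=> x _; exact: v_nd.
have -> : (\int[mu]_x ereal_sup (range (fun K => (v K x)%:E)) =
    \int[mu]_x limn (fun K => (v K x)%:E))%E.
  apply: eq_integral => x _; apply/esym/cvg_lim => //.
  exact: ereal_nondecreasing_cvgn.
rewrite monotone_convergence //.
- by apply: cvg_lim => //; exact: ereal_nondecreasing_cvgn.
- by move=> K; exact/measurable_EFinP.
- by move=> K x _; rewrite lee_fin.
Qed.

Section TMeans.
Variables (R : realType) (m : nat -> nat).
Hypothesis m_ge2 : forall k, (2 <= m k)%N.
Variables (mu : probability (vilenkin m) R) (q : nat -> R).
Hypotheses (q_ge0 : forall k, 0 <= q k)
  (q_nondecreasing : forall k l, (k <= l)%N -> q k <= q l)
  (q0_gt0 : 0 < q 0%N).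
Implicit Types (f : nat -> vilenkin m -> R[i]).

Lemma Qsum_gt0 n : (0 < n)%N -> 0 < Qsum q n.
Proof.
by case: n => // n _; rewrite /Qsum big_ord_recl ltr_pwDl // sumr_ge0.
Qed.

(** The asymptotic bound holds from some [N] on; the finitely many earlier ratios are added to the
    constant. *)
Lemma Qsum_bigO :
  (fun n : nat => q n.-1 / Qsum q n) =O_\oo (fun n : nat => (n%:R : R)^-1) ->
  exists2 C : R, 0 <= C & forall n, (0 < n)%N -> n%:R * q n.-1 <= C * Qsum q n.
Proof.
move/eqO_exP => [k k0 [N _ hN]].
have Qsum_ge0 n : 0 <= Qsum q n by exact: sumr_ge0.
have c0 n : 0 <= n%:R * q n.-1 / Qsum q n by rewrite divr_ge0 ?mulr_ge0.
exists (k + \sum_(n < N) n%:R * q n.-1 / Qsum q n).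
  by rewrite addr_ge0 ?(ltW k0) ?sumr_ge0.
move=> n n0; rewrite -ler_pdivrMr ?Qsum_gt0 //.
have [Nn|nN] := leqP N n.
  have := hN n Nn; rewrite /= ger0_norm ?divr_ge0 //.
  rewrite ger0_norm ?invr_ge0 // ler_pdivlMr ?ltr0n // => h.
  by rewrite -mulrA mulrC (le_trans h) // lerDl sumr_ge0.
by rewrite (bigD1 (Ordinal nN)) //= addrCA lerDl addr_ge0 ?(ltW k0) ?sumr_ge0.
Qed.

(** Abel summation: each partial sum is the difference of two consecutive [sum_partial_sums]. *)
Lemma sum_q_partial_sum f n x :
  \sum_(k < n.+1) (q k)%:C%C * partial_sum mu f k x =
  (q n)%:C%C * sum_partial_sums R m mu f n.+1 x -
  \sum_(k < n) (q k.+1 - q k)%:C%C * sum_partial_sums R m mu f k.+1 x.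
Proof.
elim: n => [|n IH].
  by rewrite /sum_partial_sums !big_ord1 big_ord0 subr0.
rewrite big_ord_recr /= IH [in RHS]big_ord_recr /=.
rewrite /sum_partial_sums [in RHS]big_ord_recr /= rmorphB /=; ring.
Qed.

(** As [q] is nondecreasing, the Abel coefficients have total size at most
    [q_(n-1) + (q_(n-1) - q_0) <= 2 q_(n-1)], and [n q_(n-1) <= C Q_n] absorbs the factor [n]. *)
Lemma Tmean_le f (W : nat -> R) (C h : R) n x : 0 <= h ->
  (forall k, 0 <= W k) -> {homo W : n k / (n <= k)%N >-> n <= k} ->
  (forall n, (0 < n)%N -> n%:R * q n.-1 <= C * Qsum q n) ->
  (0 < n)%N ->
  (forall k, (0 < k <= n)%N ->
    cabs (sum_partial_sums R m mu f k x) <= h * (k%:R * W k)) ->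
  cabs (Tmean mu q f n x) <= 2 * C * h * W n.
Proof.
case: n => // n h0 W0 Wle qC _ hA.
have Q0 := Qsum_gt0 n.+1 isT.
have hW k : (k <= n)%N -> cabs (sum_partial_sums R m mu f k.+1 x) <=
    h * (n.+1%:R * W n.+1).
  move=> kn; apply: le_trans (hA _ _) _; first by rewrite /= ltnS.
  by rewrite ler_wpM2l // ler_pM // ?ler_nat ?ltnS // Wle.
have hW0 : 0 <= h * (n.+1%:R * W n.+1) by rewrite !mulr_ge0.
have h1 : cabs (\sum_(k < n.+1) (q k)%:C%C * partial_sum mu f k x) <=
    2 * q n * (h * (n.+1%:R * W n.+1)).
  rewrite sum_q_partial_sum (le_trans (cabsB_le _ _ _)) //.
  rewrite mulrDl mul1r [leRHS]mulrDl lerD //.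
    by rewrite cabsM cabs_real ger0_norm // ler_wpM2l // hW.
  apply: le_trans (cabs_sum_le _ _ _ _ _) _.
  apply: (@le_trans _ _ (\sum_(k < n) (q k.+1 - q k) * (h * (n.+1%:R * W n.+1)))).
    apply: ler_sum => k _; rewrite cabsM cabs_real ger0_norm; last first.
      by rewrite subr_ge0 q_nondecreasing.
    by rewrite ler_wpM2l ?subr_ge0 ?q_nondecreasing // hW // ltnW.
  rewrite -mulr_suml ler_wpM2r // -(big_mkord xpredT (fun k => q k.+1 - q k)).
  by rewrite telescope_sumr // gerBl.
rewrite /Tmean cabsM cabs_real ger0_norm ?invr_ge0 ?(ltW Q0) //.
rewrite mulrC ler_pdivrMr // (le_trans h1) //.
have := qC n.+1 isT; rewrite /= => qCn.
rewrite [leLHS](_ : _ = 2 * h * W n.+1 * (n.+1%:R * q n)); last by ring.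
rewrite [leRHS](_ : _ = 2 * h * W n.+1 * (C * Qsum q n.+1)); last by ring.
by rewrite ler_wpM2l // !mulr_ge0.
Qed.

Lemma Tmean_cylindrical f n N : (n < Mprod m N)%N ->
  cylindrical m N (Tmean mu q f n).
Proof.
move=> nN x y xy; congr (_ * _); apply: eq_bigr => k _; congr (_ * _).
apply: eq_bigr => j _; congr (_ * _); apply: psi_cylindrical xy => //.
exact: ltn_trans (ltn_trans (ltn_ord j) (ltn_ord k)) nN.
Qed.

End TMeans.

(** * Boundedness of the weighted maximal operator *)

Theorem theorem2 (R : realType) (m : nat -> nat)
    (m_ge2 : forall k, (2 <= m k)%N)
    (m_bounded : exists B : nat, forall k, (m k <= B)%N)
    (mu : probability (vilenkin m) R) (mu_haar : haar mu)
    (p : R) (p_gt0 : 0 < p) (p_le : p <= 2^-1)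
    (q : nat -> R) (q_ge0 : forall k, 0 <= q k)
    (q_nondecreasing : forall k l, (k <= l)%N -> q k <= q l)
    (q0_gt0 : 0 < q 0%N)
    (q_bigO : (fun n : nat => q n.-1 / Qsum q n) =O_\oo
              (fun n : nat => (n%:R : R)^-1)) :
  exists c : R, forall f : nat -> vilenkin m -> R[i], Hp mu p f ->
    (Lnorm mu p%:E (Tmax mu p q f) <= c%:E * Hp_norm mu p f)%E.
Proof.
have [B m_le] := m_bounded.
have [Cq Cq0 qC] := Qsum_bigO R q q_ge0 q0_gt0 q_bigO.
have [C C0 fejer] := fejer_dominated R m B m_ge2 m_le mu p mu_haar p_gt0 p_le.
(* [(2 * Cq) ^ p] is the loss in passing to [T] means and [C] the loss in [fejer_dominated], both at
   the level of [p]-th powers; the root [D ^ (1 / p)] is the operator bound. *)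
pose D := (2 * Cq) `^ p * C.
have D0 : 0 <= D by rewrite mulr_ge0 // powR_ge0.
exists (D `^ p^-1) => f [f_mart _].
pose Tpow n x := (cabs (Tmean mu q f n x) / Tweight p n) `^ p.
(* Truncating at [n < M_K] gives functions of level [K], whose integrals are finite averages and
   which increase to the [p]-th power of [Tmax]. *)
pose T K x := \big[Num.max/0]_(n < Mprod m K | (0 < n)%N) Tpow n x.
have T_ge0 K x : 0 <= T K x by exact: bigmax_ge_id.
have T_ge K n x : (0 < n < Mprod m K)%N -> Tpow n x <= T K x.
  move=> /andP[n0 nK].
  exact: (le_bigmax_cond _ (fun i : 'I_(Mprod m K) => Tpow i x) (j := Ordinal nK)).
have T_leS K x : T K x <= T K.+1 x.
  apply/bigmax_leP; split=> // n n0; apply: T_ge; rewrite n0 /=.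
  by rewrite (leq_trans (ltn_ord n)) // leq_Mprod_mono.
have T_cyl K : cylindrical m K (T K).
  move=> x y xy; apply: eq_bigr => n _; rewrite /Tpow.
  by rewrite (Tmean_cylindrical R m m_ge2 mu q f n K _ x y xy).
have Tmax_pow x : (`|Tmax mu p q f x| `^ p)%E = ereal_sup (range (fun K => (T K x)%:E)).
  apply: poweR_ereal_sup => //; first by exists 1%N.
  - by move=> n /= n0; rewrite divr_ge0 ?cabs_ge0 // ltW // Tweight_gt0.
  - by move=> K r r0 H; apply/bigmax_leP; split=> // n n0; exact: H.
  - by move=> n /= n0; exists n; apply: T_ge; rewrite n0 ltn_Mprod.
have G_cyl K := running_max_cylindrical R m mu p f K f_mart.
have max_pow x : (`|maximal f x| `^ p)%E =
    ereal_sup (range (fun K => (running_max R m p f K x)%:E)).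
  apply: (poweR_ereal_sup R p setT (fun n => cabs (f n x))) => //.
  - by move=> n _; exact: cabs_ge0.
  - by move=> K; exact: running_max_ge0.
  - by move=> K r r0 H; apply/bigmax_leP; split=> // n _; exact: H.
  - by move=> n _; exists n; exact: running_max_ge.
have T_avg K : avg K (T K) <= D * avg K (running_max R m p f K).
  have [H [H0 HA Havg]] := fejer f K f_mart.
  apply: (@le_trans _ _ (avg K (fun x => (2 * Cq) `^ p * H x))); last first.
    by rewrite avgZ /D -mulrA ler_wpM2l ?powR_ge0.
  apply: ler_avg => x; apply/bigmax_leP.
  split=> [|n n0]; first by rewrite mulr_ge0 ?powR_ge0.
  have Wn := Tweight_gt0 R p p_gt0 p_le n n0.
  have HpE : (H x `^ p^-1) `^ p = H x.
    by rewrite -powRrM mulVf ?gt_eqF // powRr1.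
  (* [Tmean_le] is applied pointwise with [h = H x ^ (1 / p)], the bound for the sums of partial
     sums at [x]. *)
  have Tn : cabs (Tmean mu q f n x) <= 2 * Cq * H x `^ p^-1 * Tweight p n.
    apply: (Tmean_le R m mu q q_ge0 q_nondecreasing q0_gt0) => //.
    - exact: powR_ge0.
    - by move=> k; rewrite mulr_ge0 ?powR_ge0 // exprz_ge0 // ln_ge0 // ler1n.
    - exact: Tweight_le.
    move=> k /andP[k0 kn]; have kW : 0 < k%:R * Tweight p k.
      by rewrite mulr_gt0 ?ltr0n // Tweight_gt0.
    rewrite -ler_pdivrMr //; apply: le_powR_inv => //.
      by rewrite divr_ge0 ?cabs_ge0 ?(ltW kW).
    by apply: HA; rewrite k0 (leq_ltn_trans kn).
  rewrite /Tpow -HpE -powRM ?powR_ge0 ?mulr_ge0 //.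
  rewrite ge0_ler_powR ?nnegrE ?(ltW p_gt0) ?mulr_ge0 ?powR_ge0 //.
  - exact: cabs_ge0.
  - by rewrite invr_ge0 ltW.
  - by rewrite ler_pdivrMr.
rewrite /Hp_norm unlock /=.
rewrite (eq_integral (fun x => ereal_sup (range (fun K => (T K x)%:E)))); last first.
  by move=> x _; rewrite -Tmax_pow.
rewrite [X in (_ <= _ * X `^ _)%E](eq_integral (fun x =>
  ereal_sup (range (fun K => (running_max R m p f K x)%:E)))); last first.
  by move=> x _; rewrite -max_pow.
rewrite integral_ereal_sup //; last first.
  by move=> K; apply: measurable_cylindrical (T_cyl K).
rewrite integral_ereal_sup //; last 3 first.
- by move=> K; apply: measurable_cylindrical (G_cyl K).
- by move=> K x; exact: running_max_ge0.
- by move=> K x; exact: running_max_leS.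
set I := (X in (_ <= _ * X `^ _)%E).
have IG K : ((avg K (running_max R m p f K))%:E <= I)%E.
  rewrite -(integral_cylindrical R m m_ge2 mu mu_haar _ _ (G_cyl K)).
  by apply: ereal_sup_ubound; exists K.
have I0 : (0 <= I)%E.
  apply: le_trans (IG 0%N); rewrite lee_fin; apply: avg_ge0 => x.
  exact: running_max_ge0.
(* The averaged inequality holds at each [K] with the same [D], so it passes to the suprema, that
   is, to the integrals of the maximal functions. *)
set J := ereal_sup _; have JI : (J <= D%:E * I)%E.
  apply: ge_ereal_sup => _ [K _ <-].
  rewrite (integral_cylindrical R m m_ge2 mu mu_haar _ _ (T_cyl K)).
  apply: (@le_trans _ _ (D%:E * (avg K (running_max R m p f K))%:E)%E).
    by rewrite -EFinM lee_fin.
  by rewrite lee_wpmul2l // lee_fin.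
have J0 : (0 <= J)%E.
  apply: (@le_trans _ _ (\int[mu]_x (T 0%N x)%:E)%E).
    by apply: integral_ge0 => x _; rewrite lee_fin.
  by apply: ereal_sup_ubound; exists 0%N.
rewrite -poweR_EFin -poweRM ?lee_fin //.
apply: gt0_ler_poweR; rewrite ?invr_ge0 ?(ltW p_gt0) // in_itv /= leey andbT //.
by rewrite mule_ge0 // lee_fin.
Qed.
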